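(* Let $\mathbf{k}$ be a commutative noetherian ring and let $G$ be a flat affine group scheme over $\mathbf{k}$. Assume that for every finitely generated commutative $\mathbf{k}$-algebra $A$ on which $G$ acts through algebra automorphisms, the subring of invariants $A^G$ is a finitely generated $\mathbf{k}$-algebra. Then $G$ is power reductive over $\mathbf{k}$.
   Context: $G$ is not assumed algebraic, i.e. the coordinate algebra $\mathbf{k}[G]$ need not be a finitely generated $\mathbf{k}$-algebra. A $G$-module is a $\mathbf{k}$-module with a comodule structure over the Hopf algebra $\mathbf{k}[G]$; $M^G$ denotes the invariants of a $G$-module $M$ (equivalently $\mathrm{Hom}_G(\mathbf{k},M)$, where $\mathbf{k}$ has trivial action). Commutative $\mathbf{k}$-algebras are unital and may have zero-divisors and nilpotents. $G$ acts on a $\mathbf{k}$-algebra $A$ through algebra automorphisms if $A$ is a $G$-module and the multiplication map $A\otimes_{\mathbf{k}}A\to A$ is a map of $G$-modules. Power reductivity: $G$ is power reductive over $\mathbf{k}$ if for every surjective map of $G$-modules $\varphi:M\to\mathbf{k}$ (with trivial action on $\mathbf{k}$) there is a positive integer $d$ such that the $d$-th symmetric power $S^d\varphi:S^dM\to S^d\mathbf{k}$ (symmetric powers over $\mathbf{k}$) is a split surjection of $G$-modules, i.e. the kernel of $S^d\varphi$ has a $G$-stable complement in $S^dM$. *)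

(* Defs.v *)
From HB Require Import structures.
From mathcomp Require Import all_boot all_algebra.
From mathcomp Require Import boolp.
Set Implicit Arguments.
Unset Strict Implicit.
Unset Printing Implicit Defensive.

Import GRing.Theory.
Local Open Scope ring_scope.
Local Open Scope quotient_scope.

(* A commutative k-algebra, presented by its structure morphism; MathComp's
   comAlgType k excludes the zero algebra, hence also k = 0. *)
Record comAlgebra (k : comPzRingType) := ComAlgebra {
  alg_ring : comPzRingType;
  alg_map : {rmorphism k -> alg_ring}
}.

Section AlgebraModule.
Variable k : comPzRingType.

Definition alg_sort (A : comAlgebra k) : Type := alg_ring A.
Coercion alg_sort : comAlgebra >-> Sortclass.

Variable A : comAlgebra k.
HB.instance Definition _ := GRing.ComPzRing.on (alg_sort A).

Definition alg_scale (a : k) (x : A) : A := alg_map A a * x.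

Fact alg_scaleA a b x : alg_scale a (alg_scale b x) = alg_scale (a * b) x.
Proof. by rewrite /alg_scale mulrA rmorphM. Qed.

Fact alg_scale1 : left_id 1 alg_scale.
Proof. by move=> x; rewrite /alg_scale rmorph1 mul1r. Qed.

Fact alg_scaleDr : right_distributive alg_scale +%R.
Proof. by move=> a x y; rewrite /alg_scale mulrDr. Qed.

Fact alg_scaleDl x : {morph alg_scale^~ x : a b / a + b}.
Proof. by move=> a b; rewrite /alg_scale rmorphD mulrDl. Qed.

HB.instance Definition _ := GRing.Zmodule_isLmodule.Build k (alg_sort A)
  alg_scaleA alg_scale1 alg_scaleDr alg_scaleDl.

Lemma alg_scaleAl (a : k) (x y : A) : a *: (x * y) = (a *: x) * y.
Proof. exact: mulrA. Qed.

Lemma alg_scaleAr (a : k) (x y : A) : a *: (x * y) = x * (a *: y).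
Proof. exact: mulrCA. Qed.

End AlgebraModule.

Section Presentation.
Variables (k : comPzRingType) (X : choiceType).

(* The formal sum of the p.1 *: p.2, for p in s. *)
Definition formal_sum : Type := seq (k * X).
HB.instance Definition _ := Choice.on formal_sum.

Variable rel : formal_sum -> formal_sum -> Prop.

Definition formal_scale (a : k) (s : formal_sum) : formal_sum :=
  [seq (a * p.1, p.2) | p <- s].

Inductive pres_eq : formal_sum -> formal_sum -> Prop :=
| PresRel s t : rel s t -> pres_eq s t
| PresRefl s : pres_eq s s
| PresSym s t : pres_eq s t -> pres_eq t s
| PresTrans s t u : pres_eq s t -> pres_eq t u -> pres_eq s u
| PresCat s s' t t' :
    pres_eq s s' -> pres_eq t t' -> pres_eq (s ++ t) (s' ++ t')
| PresCatC s t : pres_eq (s ++ t) (t ++ s)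
| PresScale a s t :
    pres_eq s t -> pres_eq (formal_scale a s) (formal_scale a t)
| PresD a b x : pres_eq [:: (a + b, x)] [:: (a, x); (b, x)]
| Pres0 x : pres_eq [:: (0, x)] [::].

Definition pres_eqb (s t : formal_sum) : bool := `[< pres_eq s t >].

Lemma pres_eqb_refl : reflexive pres_eqb.
Proof. by move=> s; apply/asboolP; apply: PresRefl. Qed.

Lemma pres_eqb_sym : symmetric pres_eqb.
Proof. by move=> s t; apply/asboolP/asboolP; apply: PresSym. Qed.

Lemma pres_eqb_trans : transitive pres_eqb.
Proof.
by move=> t s u /asboolP st /asboolP tu; apply/asboolP; apply: PresTrans st tu.
Qed.

Canonical pres_equiv := EquivRel pres_eqb pres_eqb_refl pres_eqb_sym
  pres_eqb_trans.

(* The k-module with generators X and relations s = t whenever rel s t. *)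
Definition pres : Type := {eq_quot pres_equiv}.
HB.instance Definition _ := Choice.on pres.
HB.instance Definition _ := Quotient.on pres.

Implicit Types u v w : pres.

Definition pres_cls (s : formal_sum) : pres := \pi_({eq_quot pres_equiv}) s.

Lemma pres_clsP s t : pres_cls s = pres_cls t <-> pres_eq s t.
Proof.
split=> [/eqmodP/asboolP //|st].
by apply/eqmodP/asboolP.
Qed.

Lemma pres_cls_repr u : pres_cls (repr u) = u.
Proof. exact: reprK. Qed.

Lemma repr_pres_cls s : pres_eq (repr (pres_cls s)) s.
Proof. by apply/pres_clsP; rewrite pres_cls_repr. Qed.

Definition pres_zero : pres := pres_cls [::].
Definition pres_add u v : pres := pres_cls (repr u ++ repr v).
Definition pres_scale a u : pres := pres_cls (formal_scale a (repr u)).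
Definition pres_opp u : pres := pres_scale (- 1) u.

Lemma pres_addE s t : pres_add (pres_cls s) (pres_cls t) = pres_cls (s ++ t).
Proof. by apply/pres_clsP; apply: PresCat; apply: repr_pres_cls. Qed.

Lemma pres_scaleE a s : pres_scale a (pres_cls s) = pres_cls (formal_scale a s).
Proof. by apply/pres_clsP; apply: PresScale; apply: repr_pres_cls. Qed.

Lemma pres_case (P : pres -> Prop) : (forall s, P (pres_cls s)) -> forall u, P u.
Proof. by move=> Ps u; rewrite -[u]pres_cls_repr. Qed.

Fact pres_addA : associative pres_add.
Proof.
move=> u v w; elim/pres_case: u => s; elim/pres_case: v => t.
by elim/pres_case: w => r; rewrite !pres_addE catA.
Qed.

Fact pres_addC : commutative pres_add.
Proof.
move=> u v; elim/pres_case: u => s; elim/pres_case: v => t.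
by rewrite !pres_addE; apply/pres_clsP; apply: PresCatC.
Qed.

Fact pres_add0 : left_id pres_zero pres_add.
Proof. by elim/pres_case=> s; rewrite pres_addE. Qed.

Lemma formal_scaleD a b s :
  pres_eq (formal_scale (a + b) s) (formal_scale a s ++ formal_scale b s).
Proof.
elim: s => [|[c x] s IHs] /=; first exact: PresRefl.
rewrite mulrDl -cat1s -[_ :: _ ++ _]cat1s.
apply: PresTrans (PresCat (PresD _ _ _) IHs) _ => /=.
rewrite -cat1s -[X in pres_eq _ X]cat1s; apply: PresCat; first exact: PresRefl.
rewrite -cat1s !catA -[X in pres_eq _ (_ ++ X)]cat1s catA.
by apply: PresCat; [apply: PresCatC | apply: PresRefl].
Qed.

Lemma formal_scale0 s : pres_eq (formal_scale 0 s) [::].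
Proof.
elim: s => [|[c x] s IHs] /=; first exact: PresRefl.
by rewrite mul0r -cat1s -[[::]]cats0; apply: PresCat IHs; apply: Pres0.
Qed.

Lemma formal_scale1 s : formal_scale 1 s = s.
Proof. by elim: s => [|[c x] s IHs] //=; rewrite mul1r IHs. Qed.

Fact pres_addN : left_inverse pres_zero pres_opp pres_add.
Proof.
elim/pres_case=> s; rewrite /pres_opp pres_scaleE pres_addE; apply/pres_clsP.
rewrite -{2}[s]formal_scale1.
apply: PresTrans (PresSym (formal_scaleD _ _ _)) _.
by rewrite addNr; apply: formal_scale0.
Qed.

HB.instance Definition _ :=
  GRing.isZmodule.Build pres pres_addA pres_addC pres_add0 pres_addN.

Lemma pres_clsD s t : pres_cls (s ++ t) = pres_cls s + pres_cls t.
Proof. by rewrite -pres_addE. Qed.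

Fact pres_scaleA a b u :
  pres_scale a (pres_scale b u) = pres_scale (a * b) u.
Proof.
elim/pres_case: u => s; rewrite !pres_scaleE /formal_scale -map_comp.
by congr pres_cls; apply: eq_map => -[c x] /=; rewrite mulrA.
Qed.

Fact pres_scale1 : left_id 1 pres_scale.
Proof. by elim/pres_case=> s; rewrite pres_scaleE formal_scale1. Qed.

Fact pres_scaleDr : right_distributive pres_scale +%R.
Proof.
move=> a; elim/pres_case=> s; elim/pres_case=> t.
by rewrite -pres_clsD !pres_scaleE -pres_clsD /formal_scale map_cat.
Qed.

Fact pres_scaleDl u : {morph pres_scale^~ u : a b / a + b}.
Proof.
move=> a b; elim/pres_case: u => s.
rewrite !pres_scaleE -pres_clsD; apply/pres_clsP.
exact: formal_scaleD.
Qed.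

HB.instance Definition _ := GRing.Zmodule_isLmodule.Build k pres
  pres_scaleA pres_scale1 pres_scaleDr pres_scaleDl.

Lemma pres_clsZ a s : pres_cls (formal_scale a s) = a *: pres_cls s.
Proof. by rewrite -pres_scaleE. Qed.

Definition pres_gen (x : X) : pres := pres_cls [:: (1, x)].

Definition formal_eval (P : lmodType k) (f : X -> P) (s : formal_sum) : P :=
  \sum_(p <- s) p.1 *: f p.2.

Lemma pres_clsE s : pres_cls s = formal_eval pres_gen s.
Proof.
elim: s => [|[a x] s IHs]; first by rewrite /formal_eval big_nil.
rewrite /formal_eval big_cons -/(formal_eval _ _) -IHs.
by rewrite -pres_clsZ -pres_clsD /= mulr1.
Qed.

Lemma pres_rel s t : rel s t -> formal_eval pres_gen s = formal_eval pres_gen t.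
Proof. by move=> st; rewrite -!pres_clsE; apply/pres_clsP; apply: PresRel. Qed.

Lemma pres_ind (S : pres -> Prop) :
    S 0 -> (forall a x, S (a *: pres_gen x)) ->
    (forall u v, S u -> S v -> S (u + v)) ->
  forall u, S u.
Proof.
move=> S0 Sg SD; elim/pres_case=> s; rewrite pres_clsE /formal_eval.
by elim: s => [|p s IHs]; rewrite ?big_nil ?big_cons //; apply: SD.
Qed.

Definition pres_compat (P : lmodType k) (f : X -> P) : Prop :=
  forall s t, rel s t -> formal_eval f s = formal_eval f t.

Section Lift.
Variables (P : lmodType k) (f : X -> P) (fP : pres_compat f).

Definition pres_lift of pres_compat f := fun u : pres => formal_eval f (repr u).

Lemma formal_eval_cat s t : formal_eval f (s ++ t) = formal_eval f s + formal_eval f t.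
Proof. by rewrite /formal_eval big_cat. Qed.

Lemma formal_eval_scale a s : formal_eval f (formal_scale a s) = a *: formal_eval f s.
Proof.
by rewrite /formal_eval big_map scaler_sumr; apply: eq_bigr => p _; rewrite scalerA.
Qed.

Lemma formal_eval_eq s t : pres_eq s t -> formal_eval f s = formal_eval f t.
Proof.
elim=> {s t} [s t /fP//|//|s t _ -> //|s t u _ -> _ -> //|||||].
- by move=> s s' t t' _ IHs _ IHt; rewrite !formal_eval_cat IHs IHt.
- by move=> s t; rewrite !formal_eval_cat addrC.
- by move=> a s t _ IH; rewrite !formal_eval_scale IH.
- by move=> a b x; rewrite /formal_eval !(big_cons, big_nil) /= !addr0 scalerDl.
- by move=> x; rewrite /formal_eval !(big_cons, big_nil) /= scale0r addr0.
Qed.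

Lemma pres_lift_cls s : pres_lift fP (pres_cls s) = formal_eval f s.
Proof. by apply: formal_eval_eq; apply: repr_pres_cls. Qed.

Fact pres_lift_linear : linear (pres_lift fP).
Proof.
move=> a u v; elim/pres_case: u => s; elim/pres_case: v => t.
rewrite -pres_clsZ -pres_clsD !pres_lift_cls.
by rewrite formal_eval_cat formal_eval_scale.
Qed.
HB.instance Definition _ :=
  GRing.isLinear.Build k pres P *:%R (pres_lift fP) pres_lift_linear.

Lemma pres_liftZ a u : pres_lift fP (a *: u) = a *: pres_lift fP u.
Proof. exact: linearZZ. Qed.

Lemma pres_liftD u v : pres_lift fP (u + v) = pres_lift fP u + pres_lift fP v.
Proof. exact: linearD. Qed.

Lemma pres_lift_gen x : pres_lift fP (pres_gen x) = f x.
Proof. by rewrite pres_lift_cls /formal_eval big_seq1 scale1r. Qed.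
End Lift.

Lemma pres_ext (P : lmodType k) (f g : {linear pres -> P}) :
  (forall x, f (pres_gen x) = g (pres_gen x)) -> f =1 g.
Proof.
move=> fg; elim/pres_case=> s; rewrite pres_clsE /formal_eval !linear_sum.
by apply: eq_bigr => p _; rewrite !linearZ /= fg.
Qed.

End Presentation.

Section Tensor.
Variable k : comPzRingType.

Definition bilin (M N P : lmodType k) (f : M -> N -> P) : Prop :=
  (forall n, linear (f^~ n)) /\ (forall m, linear (f m)).

Inductive tens_rel (M N : lmodType k) :
    formal_sum k (M * N)%type -> formal_sum k (M * N)%type -> Prop :=
| TensDl m m' n :
    tens_rel [:: (1, (m + m', n))] [:: (1, (m, n)); (1, (m', n))]
| TensDr m n n' :
    tens_rel [:: (1, (m, n + n'))] [:: (1, (m, n)); (1, (m, n'))]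
| TensZl a m n : tens_rel [:: (1, (a *: m, n))] [:: (a, (m, n))]
| TensZr a m n : tens_rel [:: (1, (m, a *: n))] [:: (a, (m, n))].

Definition tens (M N : lmodType k) : Type := pres (@tens_rel M N).
HB.instance Definition _ M N := GRing.Lmodule.on (tens M N).

Definition tpure (M N : lmodType k) (m : M) (n : N) : tens M N :=
  pres_gen (@tens_rel M N) (m, n).

End Tensor.

Arguments tens {k} (M N)%_type.
Notation "M \ox N" := (tens M N) (at level 40, left associativity) : type_scope.
Notation "m \ot n" := (tpure m n) (at level 40, left associativity) : ring_scope.

Section TensorMaps.
Variable k : comPzRingType.
Implicit Types M N P Q : lmodType k.

Lemma tpureDl M N (n : N) : {morph (fun m : M => m \ot n) : m m' / m + m'}.
Proof.
move=> m m'; have := pres_rel (TensDl m m' n).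
by rewrite /formal_eval !(big_cons, big_nil) /= !addr0 !scale1r.
Qed.

Lemma tpureDr M N (m : M) : {morph (fun n : N => m \ot n) : n n' / n + n'}.
Proof.
move=> n n'; have := pres_rel (TensDr m n n').
by rewrite /formal_eval !(big_cons, big_nil) /= !addr0 !scale1r.
Qed.

Lemma tpureZl M N a (m : M) (n : N) : (a *: m) \ot n = a *: (m \ot n).
Proof.
have := pres_rel (TensZl a m n).
by rewrite /formal_eval !(big_cons, big_nil) /= !addr0 !scale1r.
Qed.

Lemma tpureZr M N a (m : M) (n : N) : m \ot (a *: n) = a *: (m \ot n).
Proof.
have := pres_rel (TensZr a m n).
by rewrite /formal_eval !(big_cons, big_nil) /= !addr0 !scale1r.
Qed.

Fact tpure_linear M N (m : M) : linear (@tpure k M N m).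
Proof. by move=> a n n'; rewrite tpureDr tpureZr. Qed.
HB.instance Definition _ M N (m : M) :=
  GRing.isLinear.Build k N (M \ox N) *:%R (@tpure k M N m) (tpure_linear m).

Definition tpurer M N (n : N) : M -> M \ox N := fun m => m \ot n.
Fact tpurer_linear M N (n : N) : linear (@tpurer M N n).
Proof. by move=> a m m'; rewrite /tpurer tpureDl tpureZl. Qed.
HB.instance Definition _ M N (n : N) :=
  GRing.isLinear.Build k M (M \ox N) *:%R (@tpurer M N n) (tpurer_linear n).

Lemma tpure_bilin M N : bilin (@tpure k M N).
Proof.
split=> [n|m]; last exact: tpure_linear.
by move=> a m m'; rewrite tpureDl tpureZl.
Qed.

Section Lift.
Variables (M N P : lmodType k) (f : M -> N -> P) (fP : bilin f).

Fact tens_compat : pres_compat (@tens_rel k M N) (fun p => f p.1 p.2).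
Proof.
case: fP => fl fr.
have flD n := (GRing.semilinear_linear (fl n)).2; have flZ n := (GRing.semilinear_linear (fl n)).1.
have frD m := (GRing.semilinear_linear (fr m)).2; have frZ m := (GRing.semilinear_linear (fr m)).1.
move=> s t [m m' n|m n n'|a m n|a m n];
  rewrite /formal_eval !(big_cons, big_nil) /= !addr0 !scale1r.
- exact: flD.
- exact: frD.
- exact: flZ.
- exact: frZ.
Qed.

Definition tlift : M \ox N -> P := pres_lift tens_compat.
HB.instance Definition _ := GRing.Linear.copy tlift (pres_lift tens_compat).

Lemma tliftE m n : tlift (m \ot n) = f m n.
Proof. exact: pres_lift_gen. Qed.
End Lift.

Lemma tens_ind M N (S : M \ox N -> Prop) :
    (forall m n, S (m \ot n)) -> (forall u v, S u -> S v -> S (u + v)) ->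
  forall u, S u.
Proof.
move=> Sg SD; elim/pres_case=> s; rewrite pres_clsE /formal_eval.
elim: s => [|[a [m n]] s IHs].
  by rewrite big_nil -(scale0r (0 \ot 0)) -tpureZl; apply: Sg.
by rewrite big_cons; apply: SD IHs; rewrite /= -tpureZl; apply: Sg.
Qed.

Lemma tens_ext M N P (f g : {linear M \ox N -> P}) :
  (forall m n, f (m \ot n) = g (m \ot n)) -> f =1 g.
Proof. by move=> fg; apply: pres_ext => -[m n]; apply: fg. Qed.

Fact tmap_bilin M N P Q (f : {linear M -> P}) (g : {linear N -> Q}) :
  bilin (fun m n => f m \ot g n).
Proof.
by split=> [n|m] a x y; rewrite linearP /= ?tpureDl ?tpureDr ?tpureZl ?tpureZr.
Qed.
Definition tmap M N P Q (f : {linear M -> P}) (g : {linear N -> Q}) :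
  M \ox N -> P \ox Q := tlift (tmap_bilin f g).
HB.instance Definition _ M N P Q (f : {linear M -> P}) (g : {linear N -> Q}) :=
  GRing.Linear.copy (tmap f g) (tlift (tmap_bilin f g)).

Lemma tmapE M N P Q (f : {linear M -> P}) (g : {linear N -> Q}) m n :
  tmap f g (m \ot n) = f m \ot g n.
Proof. exact: tliftE. Qed.

Fact tassoc_bilin M N P :
  bilin (fun (m : M) (v : N \ox P) => tmap (@tpure k M N m) idfun v).
Proof.
split=> [v|m]; last exact: linearP.
move=> a m m'; elim/tens_ind: v => [n p|u v IHu IHv].
  by rewrite !tmapE /= tpureDl tpureZl tpureDl tpureZl.
by rewrite !linearD /= IHu IHv addrACA.
Qed.
Definition tassoc M N P : M \ox (N \ox P) -> (M \ox N) \ox P :=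
  tlift (@tassoc_bilin M N P).
HB.instance Definition _ M N P :=
  GRing.Linear.copy (@tassoc M N P) (tlift (@tassoc_bilin M N P)).

Lemma tassocE M N P (m : M) (n : N) (p : P) :
  tassoc (m \ot (n \ot p)) = (m \ot n) \ot p.
Proof. by rewrite /tassoc tliftE tmapE. Qed.


Fact tswap_bilin_in M N P Q (v : P \ox Q) :
  bilin (fun (m : M) (n : N) => tmap (@tpure k M P m) (@tpure k N Q n) v).
Proof.
split=> [n|m] a x y; cbv beta.
  elim/tens_ind: v => [p q|u v IHu IHv]; last by rewrite !linearD /= IHu IHv addrACA.
  by rewrite !tmapE /= tpureDl tpureZl tpureDl tpureZl.
elim/tens_ind: v => [p q|u v IHu IHv]; last by rewrite !linearD /= IHu IHv addrACA.
by rewrite !tmapE /= (tpureDl q) tpureZl tpureDr tpureZr.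
Qed.

Fact tswap_bilin M N P Q :
  bilin (fun (u : M \ox N) (v : P \ox Q) => tlift (tswap_bilin_in M N v) u).
Proof.
split=> [v|u] a x y; first exact: linearP.
elim/tens_ind: u => [m n|u v IHu IHv]; first by rewrite !tliftE linearP.
by rewrite !linearD /= IHu IHv addrACA.
Qed.
Definition tswap M N P Q :
    (M \ox N) \ox (P \ox Q) -> (M \ox P) \ox (N \ox Q) :=
  tlift (@tswap_bilin M N P Q).
HB.instance Definition _ M N P Q :=
  GRing.Linear.copy (@tswap M N P Q) (tlift (@tswap_bilin M N P Q)).

Lemma tswapE M N P Q (m : M) (n : N) (p : P) (q : Q) :
  tswap ((m \ot n) \ot (p \ot q)) = (m \ot p) \ot (n \ot q).
Proof. by rewrite /tswap !tliftE tmapE. Qed.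

Section Algebra.
Variable A : comAlgebra k.

Fact tmul_bilin : bilin (fun x y : A => x * y).
Proof.
split=> [y|x] a u v; first by rewrite mulrDl -alg_scaleAl.
by rewrite mulrDr -alg_scaleAr.
Qed.
Definition tmul : A \ox A -> A := tlift tmul_bilin.
HB.instance Definition _ := GRing.Linear.copy tmul (tlift tmul_bilin).

Lemma tmulE x y : tmul (x \ot y) = x * y.
Proof. exact: tliftE. Qed.

(* (m (x) x) (x) (n (x) y) |-> beta (m (x) n) (x) x y *)
Definition tconv M N P (beta : {linear M \ox N -> P}) :
    (M \ox A) \ox (N \ox A) -> P \ox A :=
  tmap beta tmul \o @tswap M A N A.
HB.instance Definition _ M N P (beta : {linear M \ox N -> P}) :=
  GRing.Linear.copy (tconv beta) (tmap beta tmul \o @tswap M A N A).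

Lemma tconvE M N P (beta : {linear M \ox N -> P}) m n x y :
  tconv beta ((m \ot x) \ot (n \ot y)) = beta (m \ot n) \ot (x * y).
Proof. by rewrite /tconv /= tswapE tmapE /= tmulE. Qed.

Fact tcontr_bilin M (e : {linear A -> k^o}) :
  bilin (fun (m : M) (x : A) => (e x : k) *: m).
Proof.
split=> [x|m] a u v; first by rewrite scalerDr !scalerA mulrC.
by rewrite linearP scalerDl scalerA.
Qed.
(* The composite of tmap idfun e with the isomorphism M (x) k = M. *)
Definition tcontr M (e : {linear A -> k^o}) : M \ox A -> M :=
  tlift (tcontr_bilin M e).
HB.instance Definition _ M (e : {linear A -> k^o}) :=
  GRing.Linear.copy (@tcontr M e) (tlift (tcontr_bilin M e)).

Lemma tcontrE M (e : {linear A -> k^o}) (m : M) (x : A) :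
  tcontr e (m \ot x) = (e x : k) *: m.
Proof. exact: tliftE. Qed.

Fact tcontl_bilin M (e : {linear A -> k^o}) :
  bilin (fun (x : A) (m : M) => (e x : k) *: m).
Proof. by have [l r] := tcontr_bilin M e; split=> [m|x]; [apply: r|apply: l]. Qed.
(* The composite of tmap e idfun with the isomorphism k (x) M = M. *)
Definition tcontl M (e : {linear A -> k^o}) : A \ox M -> M :=
  tlift (tcontl_bilin M e).
HB.instance Definition _ M (e : {linear A -> k^o}) :=
  GRing.Linear.copy (@tcontl M e) (tlift (tcontl_bilin M e)).

Lemma tcontlE M (e : {linear A -> k^o}) (x : A) (m : M) :
  tcontl e (x \ot m) = (e x : k) *: m.
Proof. exact: tliftE. Qed.
End Algebra.

End TensorMaps.

Section SymmetricPower.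
Variable k : comPzRingType.
Implicit Types M N : lmodType k.

Inductive sym_rel M (d : nat) :
    formal_sum k (d.-tuple M) -> formal_sum k (d.-tuple M) -> Prop :=
| SymD (t t1 t2 : d.-tuple M) (s1 s2 : seq M) (m1 m2 : M) :
    t = s1 ++ (m1 + m2) :: s2 :> seq M ->
    t1 = s1 ++ m1 :: s2 :> seq M -> t2 = s1 ++ m2 :: s2 :> seq M ->
    sym_rel [:: (1, t)] [:: (1, t1); (1, t2)]
| SymZ (t t1 : d.-tuple M) (s1 s2 : seq M) (a : k) (m : M) :
    t = s1 ++ (a *: m) :: s2 :> seq M -> t1 = s1 ++ m :: s2 :> seq M ->
    sym_rel [:: (1, t)] [:: (a, t1)]
| SymPerm (t t1 : d.-tuple M) :
    perm_eq t t1 -> sym_rel [:: (1, t)] [:: (1, t1)].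

Definition sympow M (d : nat) : Type := pres (@sym_rel M d).
HB.instance Definition _ M d := GRing.Lmodule.on (sympow M d).

(* The product t_0 ... t_(d-1) in S^d M. *)
Definition symprod M d (t : d.-tuple M) : sympow M d := pres_gen (@sym_rel M d) t.

Lemma sym_compat (P : lmodType k) M d (f : d.-tuple M -> P) :
    (forall (t t1 t2 : d.-tuple M) (s1 s2 : seq M) (m1 m2 : M),
      t = s1 ++ (m1 + m2) :: s2 :> seq M ->
      t1 = s1 ++ m1 :: s2 :> seq M -> t2 = s1 ++ m2 :: s2 :> seq M ->
      f t = f t1 + f t2) ->
    (forall (t t1 : d.-tuple M) (s1 s2 : seq M) (a : k) (m : M),
      t = s1 ++ (a *: m) :: s2 :> seq M -> t1 = s1 ++ m :: s2 :> seq M ->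
      f t = a *: f t1) ->
    (forall t t1 : d.-tuple M, perm_eq t t1 -> f t = f t1) ->
  pres_compat (@sym_rel M d) f.
Proof.
move=> fD fZ fp s t [t0 t1 t2 s1 s2 m1 m2 e e1 e2|t0 t1 s1 s2 a m e e1|t0 t1 e];
  rewrite /formal_eval !(big_cons, big_nil) /= !addr0 !scale1r.
- exact: fD e e1 e2.
- exact: fZ e e1.
- exact: fp e.
Qed.

Lemma symprodD M d (t t1 t2 : d.-tuple M) (s1 s2 : seq M) (m1 m2 : M) :
    t = s1 ++ (m1 + m2) :: s2 :> seq M ->
    t1 = s1 ++ m1 :: s2 :> seq M -> t2 = s1 ++ m2 :: s2 :> seq M ->
  symprod t = symprod t1 + symprod t2.
Proof.
move=> e e1 e2; have := pres_rel (SymD e e1 e2).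
by rewrite /formal_eval !(big_cons, big_nil) /= !addr0 !scale1r.
Qed.

Lemma symprodZ M d (t t1 : d.-tuple M) (s1 s2 : seq M) (a : k) (m : M) :
    t = s1 ++ (a *: m) :: s2 :> seq M -> t1 = s1 ++ m :: s2 :> seq M ->
  symprod t = a *: symprod t1.
Proof.
move=> e e1; have := pres_rel (SymZ e e1).
by rewrite /formal_eval !(big_cons, big_nil) /= !addr0 !scale1r.
Qed.

Lemma symprod_perm M d (t t1 : d.-tuple M) :
  perm_eq t t1 -> symprod t = symprod t1.
Proof.
move=> e; have := pres_rel (SymPerm e).
by rewrite /formal_eval !(big_cons, big_nil) /= !addr0 !scale1r.
Qed.

Fact sympow_map_compat M N (f : {linear M -> N}) d :
  pres_compat (@sym_rel M d) (fun t => symprod (map_tuple f t)).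
Proof.
apply: sym_compat => [t t1 t2 s1 s2 m1 m2 e e1 e2|t t1 s1 s2 a m e e1|t t1 e].
- apply: (@symprodD _ _ _ _ _ (map f s1) (map f s2) (f m1) (f m2));
  by rewrite /= ?e ?e1 ?e2 map_cat /= ?linearD.
- apply: (@symprodZ _ _ _ _ (map f s1) (map f s2) a (f m));
  by rewrite /= ?e ?e1 map_cat /= ?linearZ.
- by apply: symprod_perm; apply: perm_map.
Qed.
Definition sympow_map M N (f : {linear M -> N}) d :
  sympow M d -> sympow N d := pres_lift (@sympow_map_compat M N f d).
HB.instance Definition _ M N (f : {linear M -> N}) d :=
  GRing.Linear.copy (@sympow_map M N f d) (pres_lift (@sympow_map_compat M N f d)).

Lemma sympow_mapE M N (f : {linear M -> N}) d (t : d.-tuple M) :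
  sympow_map f (symprod t) = symprod (map_tuple f t).
Proof. exact: pres_lift_gen. Qed.

Fact symcons_compat M d (m : M) :
  pres_compat (@sym_rel M d) (fun t => symprod (cons_tuple m t)).
Proof.
apply: sym_compat => [t t1 t2 s1 s2 m1 m2 e e1 e2|t t1 s1 s2 a n e e1|t t1 e].
- by apply: (@symprodD _ _ _ _ _ (m :: s1) s2 m1 m2); rewrite /= ?e ?e1 ?e2.
- by apply: (@symprodZ _ _ _ _ (m :: s1) s2 a n); rewrite /= ?e ?e1.
- by apply: symprod_perm; rewrite /= perm_cons.
Qed.

Fact symcons_bilin M d :
  bilin (fun (m : M) (u : sympow M d) => pres_lift (@symcons_compat M d m) u).
Proof.
split=> [u|m]; last exact: linearP.
move=> a m m'; cbv beta; elim/pres_ind: u => [|b t|u v IHu IHv].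
- by rewrite !linear0 addr0.
- rewrite !pres_liftZ !pres_lift_gen.
  rewrite (@symprodD _ _ _ (cons_tuple (a *: m) t) (cons_tuple m' t) [::] t (a *: m) m') //.
  rewrite (@symprodZ _ _ (cons_tuple (a *: m) t) (cons_tuple m t) [::] t a m) //.
  by rewrite scalerDr !scalerA mulrC.
- by rewrite !pres_liftD IHu IHv scalerDr addrACA.
Qed.
(* The multiplication M (x) S^d M -> S^(d+1) M. *)
Definition symcons M d : M \ox sympow M d -> sympow M d.+1 :=
  tlift (@symcons_bilin M d).
HB.instance Definition _ M d :=
  GRing.Linear.copy (@symcons M d) (tlift (@symcons_bilin M d)).

Lemma symconsZ M d a (u : M \ox sympow M d) :
  symcons (a *: u) = a *: symcons u.
Proof. exact: linearZZ. Qed.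

Lemma symconsE M d (m : M) (t : d.-tuple M) :
  symcons (m \ot symprod t) = symprod (cons_tuple m t).
Proof. by rewrite /symcons tliftE pres_lift_gen. Qed.

Lemma symconsC M d (m n : M) (u : sympow M d) :
  symcons (m \ot symcons (n \ot u))
    = symcons (n \ot symcons (m \ot u)).
Proof.
elim/pres_ind: u => [|b t|u v IHu IHv].
- by rewrite !linear0.
- do 2!rewrite !tpureZr !symconsZ; rewrite !symconsE; congr (_ *: _).
  by apply: symprod_perm; apply/permPl/(perm_catCA [:: m] [:: n] t).
- by rewrite !(tpureDr, linearD) /= IHu IHv.
Qed.

End SymmetricPower.

Section GroupScheme.
Variable k : comPzRingType.

(* An affine group scheme over k is given by its coordinate Hopf algebra. *)
Record affGroupScheme := AffGroupScheme {
  coordAlg : comAlgebra k;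
  comul : {linear coordAlg -> coordAlg \ox coordAlg};
  counit : {linear coordAlg -> k^o};
  antipode : {linear coordAlg -> coordAlg};
  comulA : forall x,
    tassoc (tmap idfun comul (comul x)) = tmap comul idfun (comul x);
  comul_counitr : forall x, tcontr counit (comul x) = x;
  comul_counitl : forall x, tcontl counit (comul x) = x;
  comul1 : comul 1 = (1 : coordAlg) \ot (1 : coordAlg);
  comulM : forall x y : coordAlg, comul (x * y) = tconv (@tmul k coordAlg) (comul x \ot comul y);
  counit1 : counit 1 = 1;
  counitM : forall x y : coordAlg, counit (x * y) = counit x * counit y;
  antipodel : forall x,
    tmul (tmap antipode idfun (comul x)) = (counit x : k) *: (1 : coordAlg);
  antipoder : forall x,
    tmul (tmap idfun antipode (comul x)) = (counit x : k) *: (1 : coordAlg)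
}.

Definition flat_module (F : lmodType k) : Prop :=
  forall (M N : lmodType k) (f : {linear M -> N}),
    injective f -> injective (tmap f (@idfun F)).

Variable G : affGroupScheme.
Notation H := (coordAlg G).

Definition coassociative (M : lmodType k) (rho : {linear M -> M \ox H}) (m : M) :=
  tassoc (tmap idfun (comul G) (rho m)) = tmap rho idfun (rho m).

Definition counital (M : lmodType k) (rho : {linear M -> M \ox H}) (m : M) :=
  tcontr (counit G) (rho m) = m.

Definition coaction (M : lmodType k) (rho : {linear M -> M \ox H}) : Prop :=
  (forall m, coassociative rho m) /\ (forall m, counital rho m).

Record gmodule := GModule {
  gmod_sort :> lmodType k;
  coact : {linear gmod_sort -> gmod_sort \ox H};
  coactP : coaction coact
}.

Definition gmap (M N : gmodule) (f : {linear M -> N}) : Prop :=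
  forall m, coact N (f m) = tmap f idfun (coact M m).

Definition ginvariant (M : gmodule) (m : M) : Prop :=
  coact M m = m \ot (1 : H).

Definition triv_coact : k^o -> k^o \ox H := @tpurer k k^o H 1.
HB.instance Definition _ := GRing.Linear.copy triv_coact (@tpurer k k^o H 1).

Fact triv_coaction : coaction triv_coact.
Proof.
split=> a; first by rewrite /coassociative !tmapE comul1 tassocE.
by rewrite /counital tcontrE counit1 scale1r.
Qed.

Definition trivG : gmodule := GModule triv_coaction.

Section Conv.
Variables (M N P : lmodType k) (beta : {linear M \ox N -> P}).
Variables (rM : {linear M -> M \ox H}) (rN : {linear N -> N \ox H}).
Variables (rP : {linear P -> P \ox H}).
Hypothesis rP_beta :
  forall m n, rP (beta (m \ot n)) = tconv beta (rM m \ot rN n).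

Lemma tconv_coact (u : M \ox H) (v : N \ox H) :
  tmap rP idfun (tconv beta (u \ot v))
    = tconv (tconv beta) (tmap rM idfun u \ot tmap rN idfun v).
Proof.
elim/tens_ind: u => [m g|u u' IHu IHu']; last by rewrite !(tpureDl, linearD) /= IHu IHu'.
elim/tens_ind: v => [n h|v v' IHv IHv']; last by rewrite !(tpureDr, linearD) /= IHv IHv'.
by rewrite tconvE !tmapE rP_beta tconvE.
Qed.

Lemma tconv_comul (u : M \ox H) (v : N \ox H) :
  tassoc (tmap idfun (comul G) (tconv beta (u \ot v)))
    = tconv (tconv beta) (tassoc (tmap idfun (comul G) u) \ot
                          tassoc (tmap idfun (comul G) v)).
Proof.
elim/tens_ind: u => [m g|u u' IHu IHu']; last by rewrite !(tpureDl, linearD) /= IHu IHu'.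
elim/tens_ind: v => [n h|v v' IHv IHv']; last by rewrite !(tpureDr, linearD) /= IHv IHv'.
rewrite tconvE !tmapE comulM.
elim/tens_ind: (comul G g) => [g1 g2|x x' IHx IHx'];
  last by rewrite !(tpureDl, tpureDr, linearD) /= IHx IHx'.
elim/tens_ind: (comul G h) => [h1 h2|x x' IHx IHx'];
  last by rewrite !(tpureDr, linearD) /= IHx IHx'.
by rewrite !tassocE !tconvE /= tmulE tassocE tconvE.
Qed.

Lemma tconv_counit (u : M \ox H) (v : N \ox H) :
  tcontr (counit G) (tconv beta (u \ot v))
    = beta (tcontr (counit G) u \ot tcontr (counit G) v).
Proof.
elim/tens_ind: u => [m g|u u' IHu IHu']; last by rewrite !(tpureDl, linearD) /= IHu IHu'.
elim/tens_ind: v => [n h|v v' IHv IHv']; last by rewrite !(tpureDr, linearD) /= IHv IHv'.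
rewrite tconvE !tcontrE counitM tpureZl tpureZr [RHS]linearZZ [X in _ = _ *: X]linearZZ.
by rewrite scalerA.
Qed.

Lemma coassociative_conv m n :
  coassociative rM m -> coassociative rN n -> coassociative rP (beta (m \ot n)).
Proof.
by move=> rMm rNn; rewrite /coassociative rP_beta tconv_comul tconv_coact rMm rNn.
Qed.

Lemma counital_conv m n :
  counital rM m -> counital rN n -> counital rP (beta (m \ot n)).
Proof. by move=> rMm rNn; rewrite /counital rP_beta tconv_counit rMm rNn. Qed.

End Conv.

Lemma coassociative_lin (M : lmodType k) (rho : {linear M -> M \ox H}) a m m' :
  coassociative rho m -> coassociative rho m' -> coassociative rho (a *: m + m').
Proof. by rewrite /coassociative => rm rm'; rewrite !linearP /= rm rm'. Qed.

Lemma counital_lin (M : lmodType k) (rho : {linear M -> M \ox H}) a m m' :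
  counital rho m -> counital rho m' -> counital rho (a *: m + m').
Proof. by rewrite /counital => rm rm'; rewrite !linearP /= rm rm'. Qed.

Section TensorG.
Variables M N : gmodule.

Definition tens_coact : M \ox N -> (M \ox N) \ox H :=
  tconv idfun \o tmap (coact M) (coact N).
HB.instance Definition _ := GRing.Linear.copy tens_coact
  (tconv idfun \o tmap (coact M) (coact N)).

Lemma tens_coactE m n :
  tens_coact (m \ot n) = tconv idfun (coact M m \ot coact N n).
Proof. by rewrite /tens_coact /= tmapE. Qed.

Fact tens_coaction : coaction tens_coact.
Proof.
split; elim/tens_ind=> [m n|u v IHu IHv].
- exact: (@coassociative_conv M N _ idfun _ _ _ tens_coactE m n
           ((coactP M).1 m) ((coactP N).1 n)).
- by rewrite -[u]scale1r; apply: coassociative_lin.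
- exact: (@counital_conv M N _ idfun _ _ _ tens_coactE m n
           ((coactP M).2 m) ((coactP N).2 n)).
- by rewrite -[u]scale1r; apply: counital_lin.
Qed.

Definition tensG : gmodule := GModule tens_coaction.
End TensorG.

Section SymG.
Variable M : gmodule.

(* (m_i (x) h_i)_i |-> m_0 ... m_(d-1) (x) h_0 ... h_(d-1), composed with the
   coactions of the m_i. *)
Fixpoint sympow_coact_gen (d : nat) : d.-tuple M -> sympow M d \ox H :=
  match d with
  | 0 => fun t => symprod t \ot (1 : H)
  | d'.+1 => fun t => tconv (@symcons k M d')
               (coact M (thead t) \ot sympow_coact_gen (behead_tuple t))
  end.

Lemma sympow_coact_genS d (m : M) (t : d.-tuple M) :
  sympow_coact_gen (cons_tuple m t)
    = tconv (@symcons k M d) (coact M m \ot sympow_coact_gen t).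
Proof.
by rewrite /= theadE; congr (tconv _ (_ \ot sympow_coact_gen _)); apply: val_inj.
Qed.

Lemma tconv_symconsC d (u v : M \ox H) (w : sympow M d \ox H) :
  tconv (@symcons k M d.+1) (u \ot tconv (@symcons k M d) (v \ot w))
    = tconv (@symcons k M d.+1) (v \ot tconv (@symcons k M d) (u \ot w)).
Proof.
elim/tens_ind: u => [m g|u u' IHu IHu'].
  elim/tens_ind: v => [n h|v v' IHv IHv'].
    elim/tens_ind: w => [z i|w w' IHw IHw'].
      by rewrite !tconvE /= symconsC mulrCA.
    by rewrite !(tpureDr, linearD) /= IHw IHw'.
  by rewrite !(tpureDl, tpureDr, linearD) /= IHv IHv'.
by rewrite !(tpureDl, tpureDr, linearD) /= IHu IHu'.
Qed.

Fact sympow_coact_compat d : pres_compat (@sym_rel k M d) (@sympow_coact_gen d).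
Proof.
apply: sym_compat.
- elim: d => [|d IHd] t t1 t2 s1 s2 m1 m2; first by case: s1 (tuple0 t) => [|? ?] ->.
  case/tupleP: t => x t; case/tupleP: t1 => x1 t1; case/tupleP: t2 => x2 t2.
  rewrite !sympow_coact_genS; case: s1 => [|y s1] /=.
    move=> [-> et] [-> e1] [-> e2].
    have -> : t1 = t by apply: val_inj; rewrite /= e1 et.
    have -> : t2 = t by apply: val_inj; rewrite /= e2 et.
    by rewrite [coact _ _]linearD tpureDl; apply: linearD.
  move=> [-> et] [-> e1] [-> e2].
  by rewrite (IHd _ _ _ _ _ _ _ et e1 e2) tpureDr; apply: linearD.
- elim: d => [|d IHd] t t1 s1 s2 a m; first by case: s1 (tuple0 t) => [|? ?] ->.
  case/tupleP: t => x t; case/tupleP: t1 => x1 t1.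
  rewrite !sympow_coact_genS; case: s1 => [|y s1] /=.
    move=> [-> et] [-> e1].
    have -> : t1 = t by apply: val_inj; rewrite /= e1 et.
    by rewrite [coact _ _]linearZZ tpureZl; apply: linearZZ.
  move=> [-> et] [-> e1].
  by rewrite (IHd _ _ _ _ _ _ et e1) tpureZr; apply: linearZZ.
- elim: d => [|d IHd] t t1; first by rewrite (tuple0 t) (tuple0 t1).
  case/tupleP: t => x t; case/tupleP: t1 => y t1.
  rewrite !sympow_coact_genS => exy0.
  have exy : perm_eq (x :: t) (y :: t1) := exy0.
  have [exyx|neq] := eqVneq x y.
    by move: exy; rewrite exyx perm_cons => /IHd ->.
  have yt : y \in val t.
    by have := perm_mem exy y; rewrite !inE eqxx eq_sym (negPf neq).
  have ety := perm_to_rem yt.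
  case: d IHd t t1 {exy0} exy yt ety => [|d] IHd t t1 exy yt ety.
    by rewrite tuple0 in yt.
  have su : size (rem y t) == d by rewrite size_rem // size_tuple.
  pose u := Tuple su.
  rewrite (IHd t (cons_tuple y u)) //.
  rewrite (IHd t1 (cons_tuple x u)); last first.
    rewrite -(perm_cons y) perm_sym.
    apply: perm_trans exy.
    have /permPl h := perm_catCA [:: y] [:: x] (val u).
    by apply: perm_trans h _; rewrite /= perm_cons perm_sym.
  by rewrite !sympow_coact_genS tconv_symconsC.
Qed.

Definition sympow_coact d : sympow M d -> sympow M d \ox H :=
  pres_lift (@sympow_coact_compat d).
HB.instance Definition _ d :=
  GRing.Linear.copy (@sympow_coact d) (pres_lift (@sympow_coact_compat d)).

Lemma sympow_coact0 (t : 0.-tuple M) :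
  sympow_coact (symprod t) = symprod t \ot (1 : H).
Proof. exact: pres_lift_gen. Qed.

Lemma sympow_coactS d m u :
  sympow_coact (symcons (m \ot u))
    = tconv (@symcons k M d) (coact M m \ot sympow_coact u).
Proof.
elim/pres_ind: u => [|a t|u v IHu IHv].
- by rewrite !linear0.
- rewrite tpureZr symconsZ /sympow_coact !pres_liftZ tpureZr [RHS]linearZZ.
  rewrite symconsE; congr (_ *: _).
  by rewrite !pres_lift_gen sympow_coact_genS.
- by rewrite !(tpureDr, linearD) /= IHu IHv.
Qed.

Fact sympow_coaction d : coaction (@sympow_coact d).
Proof.
have scE n a (u : sympow M n) : a *: u = a *: u + 0 by rewrite addr0.
elim: d => [|d [IHa IHu]]; split; elim/pres_ind=> [|a t|u v Hu Hv].
- by rewrite /coassociative !linear0.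
- rewrite scE; apply: coassociative_lin; last by rewrite /coassociative !linear0.
  rewrite -[pres_gen _ _]/(symprod t) /coassociative /= sympow_coact0.
  by rewrite !tmapE /= comul1 tassocE sympow_coact0.
- by rewrite -[u]scale1r; apply: coassociative_lin.
- by rewrite /counital !linear0.
- rewrite scE; apply: counital_lin; last by rewrite /counital !linear0.
  rewrite -[pres_gen _ _]/(symprod t) /counital /= sympow_coact0.
  by rewrite tcontrE counit1 scale1r.
- by rewrite -[u]scale1r; apply: counital_lin.
- by rewrite /coassociative !linear0.
- rewrite scE; apply: coassociative_lin; last by rewrite /coassociative !linear0.
  case/tupleP: t => m t; rewrite -[pres_gen _ _]/(symprod (cons_tuple m t)).
  rewrite -symconsE.
  exact: (coassociative_conv (@sympow_coactS d) ((coactP M).1 m) (IHa _)).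
- by rewrite -[u]scale1r; apply: coassociative_lin.
- by rewrite /counital !linear0.
- rewrite scE; apply: counital_lin; last by rewrite /counital !linear0.
  case/tupleP: t => m t; rewrite -[pres_gen _ _]/(symprod (cons_tuple m t)).
  rewrite -symconsE.
  exact: (counital_conv (@sympow_coactS d) ((coactP M).2 m) (IHu _)).
- by rewrite -[u]scale1r; apply: counital_lin.
Qed.

Definition sympowG d : gmodule := GModule (sympow_coaction d).
End SymG.

Definition split_gsurjection (M N : gmodule) (f : {linear M -> N}) : Prop :=
  exists s : {linear N -> M}, gmap s /\ cancel s f.

Definition power_reductive : Prop :=
  forall (M : gmodule) (phi : {linear M -> trivG}),
    gmap phi -> (forall a, exists m, phi m = a) ->
    exists2 d : nat, (0 < d)%N &
      @split_gsurjection (sympowG M d) (sympowG trivG d) (@sympow_map k M trivG phi d).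

(* A commutative k-algebra with an action of G through algebra automorphisms. *)
Record galgebra := GAlgebra {
  galg_alg :> comAlgebra k;
  galg_coact : {linear galg_alg -> galg_alg \ox H};
  galg_coactP : coaction galg_coact;
  galg_mulP : let A := GModule galg_coactP in
    @gmap (tensG A A) A (@tmul k galg_alg)
}.

Definition galg_gmod (A : galgebra) : gmodule := GModule (galg_coactP A).

End GroupScheme.

Section FiniteGeneration.
Variable k : comPzRingType.

Definition noetherian : Prop :=
  forall I : k -> Prop,
    I 0 -> (forall x y, I x -> I y -> I (x + y)) ->
    (forall a x, I x -> I (a * x)) ->
    exists (n : nat) (e : 'I_n -> k), forall x,
      I x <-> exists c : 'I_n -> k, x = \sum_(i < n) c i * e i.

Variable A : comAlgebra k.

Inductive alg_generated (s : seq A) : A -> Prop :=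
| AlgGen x : x \in s -> alg_generated s x
| AlgScal (a : k) : alg_generated s (alg_map A a)
| AlgAdd x y : alg_generated s x -> alg_generated s y -> alg_generated s (x + y)
| AlgMul x y : alg_generated s x -> alg_generated s y -> alg_generated s (x * y).

Definition fg_subalgebra (B : A -> Prop) : Prop :=
  exists s : seq A, forall x, B x <-> alg_generated s x.

Definition fg_algebra : Prop := fg_subalgebra (fun _ => True).

End FiniteGeneration.

(* Main.v *)
Require Import Defs.
From HB Require Import structures.
From mathcomp Require Import all_boot all_algebra.
From mathcomp Require Import boolp ring.
Set Implicit Arguments.
Unset Strict Implicit.
Unset Printing Implicit Defensive.

Import GRing.Theory.
Local Open Scope ring_scope.
Local Open Scope quotient_scope.

(* Since G is flat and k noetherian, every element of a G-module lies in a
   G-submodule which is finitely generated over k (Serre); so let M be finitely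
   generated, with an equivariant surjection phi : M -> k of kernel K.  Consider
   the finitely generated algebra A = S(M)[eps] / (K eps).  It is bigraded; its
   component of degree 0 in eps is S(M), and that of degree 1 is k[x] eps, with
   trivial action, where x is the class of any m1 with phi m1 = 1.
   Let I_d be the ideal of the c such that c x^d lifts to (S^d M)^G.  If A^G is
   generated by elements whose components in degree 1 in eps are of degree < D
   in x, then multiplying out the generators shows that x^D eps can only be
   invariant if 1 is in the sum of the I_d, d > 0.  As I_d I_e is contained in
   I_(d + e), taking powers gives 1 \in I_d for a single d > 0, i.e. an
   invariant of S^d M mapping to x^d. *)

(** * Submodules and quotients *)

Record submodule (k : comPzRingType) (M : lmodType k) := Submodule {
  in_submodule :> M -> Prop;
  submodule0 : in_submodule 0;
  submoduleP : forall a x y,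
    in_submodule x -> in_submodule y -> in_submodule (a *: x + y)
}.

Section Submodule.
Variables (k : comPzRingType) (M : lmodType k) (S : submodule M).

Lemma submoduleD x y : S x -> S y -> S (x + y).
Proof. by move=> Sx Sy; rewrite -[x]scale1r; apply: submoduleP. Qed.

Lemma submoduleZ a x : S x -> S (a *: x).
Proof. by move=> Sx; rewrite -[_ *: x]addr0; apply: submoduleP => //; apply: submodule0. Qed.

Lemma submoduleB x y : S x -> S y -> S (x - y).
Proof. by move=> Sx Sy; rewrite -scaleN1r; apply: submoduleD => //; apply: submoduleZ. Qed.

Lemma submodule_sum (I : Type) (r : seq I) (P : pred I) (F : I -> M) :
  (forall i, P i -> S (F i)) -> S (\sum_(i <- r | P i) F i).
Proof. by move=> SF; elim/big_ind: _ => //; [apply: submodule0 | apply: submoduleD]. Qed.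

Definition submodule_mem : M -> bool := fun x => `[< S x >].

Fact submodule_mem_closed : GRing.submod_closed submodule_mem.
Proof.
split; first by apply/asboolP/submodule0.
by move=> a x y /asboolP Sx /asboolP Sy; apply/asboolP/submoduleP.
Qed.
HB.instance Definition _ :=
  GRing.isSubmodClosed.Build k M submodule_mem submodule_mem_closed.

Definition submod_type : Type := {x : M | submodule_mem x}.
HB.instance Definition _ := SubChoice.on submod_type.
HB.instance Definition _ := [SubChoice_isSubLmodule of submod_type by <:].

Definition submod_incl : submod_type -> M := val.
HB.instance Definition _ := GRing.Linear.copy submod_incl (val : submod_type -> M).

Lemma submod_incl_inj : injective submod_incl.
Proof. exact: val_inj. Qed.

Lemma submod_inclP x : S (submod_incl x).
Proof. by apply/asboolP; apply: (valP x). Qed.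

Lemma submod_inclW x : S x -> exists y, submod_incl y = x.
Proof. by move=> /asboolP Sx; exists (exist _ x Sx). Qed.

Definition submodule_zmod : zmodClosed M := HB.pack submodule_mem.

Definition quotmod : Type := Quotient.quot submodule_zmod.
HB.instance Definition _ := GRing.Zmodule.on quotmod.
HB.instance Definition _ := Quotient.on quotmod.

Definition quotmod_pi (x : M) : quotmod := \pi_(Quotient.quot submodule_zmod) x.

Lemma quotmod_piP x y : quotmod_pi x = quotmod_pi y <-> S (x - y).
Proof.
rewrite /quotmod_pi; split=> [/eqP|Sxy]; first by rewrite piE Quotient.equivE => /asboolP.
by apply/eqP; rewrite piE Quotient.equivE; apply/asboolP.
Qed.

Lemma quotmod_reprK (q : quotmod) : quotmod_pi (repr q) = q.
Proof. exact: reprK. Qed.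

Lemma quotmod_piD x y : quotmod_pi (x + y) = quotmod_pi x + quotmod_pi y.
Proof. by rewrite /quotmod_pi !piE. Qed.

Definition quotmod_scale a (q : quotmod) : quotmod := quotmod_pi (a *: repr q).

Lemma quotmod_scaleE a x : quotmod_scale a (quotmod_pi x) = quotmod_pi (a *: x).
Proof.
apply/quotmod_piP; rewrite -scalerBr; apply: submoduleZ.
by apply/quotmod_piP; rewrite quotmod_reprK.
Qed.

Lemma quotmod_case (P : quotmod -> Prop) : (forall x, P (quotmod_pi x)) -> forall q, P q.
Proof. by move=> Px q; rewrite -[q]quotmod_reprK. Qed.

Fact quotmod_scaleA a b q :
  quotmod_scale a (quotmod_scale b q) = quotmod_scale (a * b) q.
Proof. by elim/quotmod_case: q => x; rewrite !quotmod_scaleE scalerA. Qed.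

Fact quotmod_scale1 : left_id 1 quotmod_scale.
Proof. by elim/quotmod_case=> x; rewrite quotmod_scaleE scale1r. Qed.

Fact quotmod_scaleDr : right_distributive quotmod_scale +%R.
Proof.
move=> a; elim/quotmod_case=> x; elim/quotmod_case=> y.
by rewrite -quotmod_piD !quotmod_scaleE scalerDr quotmod_piD.
Qed.

Fact quotmod_scaleDl q : {morph quotmod_scale^~ q : a b / a + b}.
Proof.
by move=> a b; elim/quotmod_case: q => x; rewrite !quotmod_scaleE scalerDl quotmod_piD.
Qed.

HB.instance Definition _ := GRing.Zmodule_isLmodule.Build k quotmod
  quotmod_scaleA quotmod_scale1 quotmod_scaleDr quotmod_scaleDl.

Fact quotmod_pi_linear : linear quotmod_pi.
Proof. by move=> a x y; rewrite quotmod_piD -quotmod_scaleE. Qed.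
HB.instance Definition _ :=
  GRing.isLinear.Build k M quotmod *:%R quotmod_pi quotmod_pi_linear.

Lemma quotmod_pi0 x : quotmod_pi x = 0 <-> S x.
Proof. by rewrite -[0](linear0 quotmod_pi) quotmod_piP subr0. Qed.

Section Lift.
Variables (P : lmodType k) (f : {linear M -> P}) (fS : forall x, S x -> f x = 0).

Definition quotmod_lift of (forall x, S x -> f x = 0) :=
  fun q : quotmod => f (repr q).

Lemma quotmod_liftE x : quotmod_lift fS (quotmod_pi x) = f x.
Proof.
apply/eqP; rewrite -subr_eq0 /quotmod_lift -linearB; apply/eqP/fS.
by apply/quotmod_piP; rewrite quotmod_reprK.
Qed.

Fact quotmod_lift_linear : linear (quotmod_lift fS).
Proof.
move=> a; elim/quotmod_case=> x; elim/quotmod_case=> y.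
by rewrite -linearP /= !quotmod_liftE linearP.
Qed.
HB.instance Definition _ :=
  GRing.isLinear.Build k quotmod P *:%R (quotmod_lift fS) quotmod_lift_linear.
End Lift.

End Submodule.

Section Kernel.
Variables (k : comPzRingType) (M P : lmodType k) (f : {linear M -> P}).

Fact ker_submodule_subproof a x y : f x = 0 -> f y = 0 -> f (a *: x + y) = 0.
Proof. by rewrite linearP => -> ->; rewrite scaler0 addr0. Qed.
Definition ker_submodule : submodule M := Submodule (linear0 f) ker_submodule_subproof.

Fact im_submodule_subproof a x y :
  (exists u, f u = x) -> (exists u, f u = y) -> exists u, f u = a *: x + y.
Proof. by move=> [u <-] [v <-]; exists (a *: u + v); rewrite linearP. Qed.
Definition im_submodule : submodule P :=
  Submodule (ex_intro _ 0 (linear0 f)) im_submodule_subproof.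

End Kernel.

(** * Finitely generated modules over a noetherian ring *)

Section Span.
Variables (k : comPzRingType) (M : lmodType k).

Inductive lin_generated (s : seq M) : M -> Prop :=
| LinGen x : x \in s -> lin_generated s x
| Lin0 : lin_generated s 0
| LinComb a x y : lin_generated s x -> lin_generated s y -> lin_generated s (a *: x + y).

Definition lin_span s : submodule M := Submodule (Lin0 s) (@LinComb s).

Lemma lin_span_sub (S : submodule M) (s : seq M) x :
  (forall y, y \in s -> S y) -> lin_span s x -> S x.
Proof.
by move=> sS; elim=> [y /sS//||a y z _ Sy _ Sz]; [apply: submodule0|apply: submoduleP].
Qed.

Lemma lin_span_mono (s t : seq M) x : {subset s <= t} -> lin_span s x -> lin_span t x.
Proof. by move=> st; apply: lin_span_sub => y /st; apply: LinGen. Qed.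

Lemma lin_span_cons x s y : lin_span (x :: s) y -> exists a z, y = a *: x + z /\ lin_span s z.
Proof.
elim=> [z||a u v _ [b [z [-> sz]]] _ [c [w [-> sw]]]].
- rewrite inE => /predU1P[->|sz].
    by exists 1, 0; rewrite scale1r addr0; split=> //; apply: Lin0.
  by exists 0, z; rewrite scale0r add0r; split=> //; apply: LinGen.
- by exists 0, 0; rewrite scale0r addr0; split=> //; apply: Lin0.
- exists (a * b + c), (a *: z + w); rewrite scalerDr scalerDl scalerA addrACA.
  by split=> //; apply: LinComb.
Qed.

(** Induction on the generators: the coefficients of the first generator [m] in elements of [S] form
    an ideal, finitely generated by hypothesis. Lifts to [S] of its generators, together with
    generators of the part of [S] inside the span of the remaining ones, generate [S]. *)
Lemma noetherian_submodule (k_noeth : noetherian k) (s : seq M) (S : submodule M) :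
    (forall x, S x -> lin_span s x) ->
  exists2 t : seq M, (forall x, x \in t -> S x) & (forall x, S x -> lin_span t x).
Proof.
elim: s S => [|m s IHs] S Ss.
  by exists [::].
pose I a := exists2 z, lin_span s z & S (a *: m + z).
have [n [e Ie]]: exists (n : nat) (e : 'I_n -> k), forall x,
      I x <-> exists c : 'I_n -> k, x = \sum_(i < n) c i * e i.
  apply: k_noeth => [|x y [z sz Sz] [w sw Sw]|a x [z sz Sz]].
  - by exists 0; [apply: Lin0 | rewrite scale0r addr0; exact: submodule0].
  - by exists (z + w); [apply: submoduleD|rewrite scalerDl addrACA; apply: submoduleD].
  - by exists (a *: z); [apply: submoduleZ|rewrite -scalerA -scalerDr; apply: submoduleZ].
have /fin_all_exists2[z sz Sz] i : exists2 z, lin_span s z & S (e i *: m + z).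
  apply/Ie; exists (fun j => (j == i)%:R).
  rewrite (bigD1 i) //= eqxx mul1r big1 ?addr0 // => j /negPf ->.
  by rewrite mul0r.
pose S' := @Submodule k M (fun x => S x /\ lin_span s x)
  (conj (submodule0 S) (Lin0 s))
  (fun a x y Hx Hy => conj (submoduleP a Hx.1 Hy.1) (LinComb a Hx.2 Hy.2)).
have [t tS' S't] := IHs S' (fun x => @proj2 _ _).
exists ([seq e i *: m + z i | i <- enum 'I_n] ++ t) => x.
  by rewrite mem_cat => /orP[/mapP[i _ ->]|/tS'[]].
move=> Sx; have [a [y [ex sy]]] := lin_span_cons (Ss x Sx).
have /Ie[c ea] : I a by exists y => //; rewrite -ex.
(* The combination [w] of the lifts can be written with the same coefficient [a] at [m] as [x], so
   [x - w] falls into [S']. *)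
pose w := \sum_(i < n) c i *: (e i *: m + z i).
have ww : lin_span [seq e i *: m + z i | i <- enum 'I_n] w.
  apply: submodule_sum => i _; apply: submoduleZ; apply: LinGen.
  by apply/mapP; exists i => //; rewrite mem_enum.
rewrite -[x](subrK w) addrC; apply: submoduleD.
  by apply: lin_span_mono ww => u us; rewrite mem_cat us.
apply: (@lin_span_mono t) => [u us|]; first by rewrite mem_cat us orbT.
apply: S't; split.
  by apply: submoduleB => //; apply: submodule_sum => i _; apply: submoduleZ.
have -> : x - w = y - \sum_(i < n) c i *: z i.
  rewrite ex ea scaler_suml /w.
  under [X in _ - X = _]eq_bigr do rewrite scalerDr scalerA.
  by rewrite big_split /= opprD addrACA subrr add0r.
by apply: submoduleB => //; apply: submodule_sum => i _; apply: submoduleZ.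
Qed.

End Span.

Definition fg_module (k : comPzRingType) (M : lmodType k) : Prop :=
  exists s : seq M, forall x, lin_span s x.

Lemma fg_submod_type (k : comPzRingType) (M : lmodType k) (S : submodule M) (s : seq M) :
    (forall x, x \in s -> S x) -> (forall x, S x -> lin_span s x) ->
  fg_module (submod_type S).
Proof.
move=> sS Ss; exists (pmap insub s) => x.
have: lin_generated s (submod_incl x) by apply/Ss/submod_inclP.
(* [x] stays general in the induction, because the two terms of a combination must themselves be
   lifted to the subtype. *)
move ey: (submod_incl x) => y sy; elim: sy x ey => [z sz x ex||a u v su Hu sv Hv x ex].
- by apply: LinGen; rewrite mem_pmap_sub; move: sz; rewrite -ex.
- by move=> x ex; rewrite (@submod_incl_inj _ _ _ x 0 ex); apply: Lin0.
have [u' eu] := submod_inclW (lin_span_sub sS su).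
have [v' ev] := submod_inclW (lin_span_sub sS sv).
have -> : x = a *: u' + v' by apply: submod_incl_inj; rewrite ex linearP /= eu ev.
by apply: LinComb; [apply: Hu|apply: Hv].
Qed.

(** * Finite support of tensors and right exactness of the tensor product *)

Section TensorExact.
Variables (k : comPzRingType).
Implicit Types M N H P : lmodType k.

Lemma tpure0l M N (n : N) : (0 : M) \ot n = 0.
Proof. exact: (linear0 (@tpurer k M N n)). Qed.

Lemma tmap_comp M M' M'' N N' N'' (f : {linear M -> M'}) (f' : {linear M' -> M''})
    (g : {linear N -> N'}) (g' : {linear N' -> N''}) u :
  tmap f' g' (tmap f g u) = tmap (f' \o f) (g' \o g) u.
Proof.
elim/tens_ind: u => [m n|u v IHu IHv]; first by rewrite (tmapE f) !tmapE.
by rewrite !linearD /= IHu IHv.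
Qed.

Lemma eq_tmap M M' N N' (f f' : {linear M -> M'}) (g g' : {linear N -> N'}) :
  f =1 f' -> g =1 g' -> tmap f g =1 tmap f' g'.
Proof. by move=> ff gg; apply: tens_ext => m n; rewrite /= (tmapE f) (tmapE f') ff gg. Qed.

(** The left factors of any expression of [u] as a sum of pure tensors will do. The property is
    phrased through maps killing [s] in order to be applied to the quotient by the span of [s]. *)
Lemma tens_support M N (u : M \ox N) :
  exists s : seq M, forall P (f : {linear M -> P}),
    (forall x, x \in s -> f x = 0) -> tmap f (@idfun N) u = 0.
Proof.
elim/tens_ind: u => [m n|u v [s Hs] [t Ht]].
  exists [:: m] => P f fs.
  by rewrite tmapE fs ?inE // tpure0l.
exists (s ++ t) => P f fst; rewrite linearD /= Hs ?Ht ?addr0 // => x xs;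
  by apply: fst; rewrite mem_cat xs ?orbT.
Qed.

Section Exact.
Variables (M H : lmodType k) (S : submodule M).
Let inc := tmap (@submod_incl _ _ S) (@idfun H).
Let T := quotmod (im_submodule inc).
Let p (h : H) : M -> T := @quotmod_pi _ _ _ \o @tpurer k M H h.

Fact quot_tens_vanish h x : S x -> p h x = 0.
Proof.
move=> /submod_inclW[y <-]; apply/quotmod_pi0; exists (y \ot h).
by rewrite /= /inc tmapE.
Qed.

Fact quot_tens_bilin :
  bilin (fun (q : quotmod S) (h : H) => quotmod_lift (@quot_tens_vanish h) q).
Proof.
split=> [h|q]; first by move=> a x y; apply: quotmod_lift_linear.
elim/quotmod_case: q => x a h h'.
by rewrite !quotmod_liftE /p /= /tpurer tpureDr tpureZr linearP.
Qed.

(** Right exactness: [quot_tens_bilin] induces a map from [quotmod S \ox H] to the cokernel [T], and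
    its composite with the map from [M \ox H] to [quotmod S \ox H] is the projection onto [T]. So
    what dies in [quotmod S \ox H] already dies in [T]. *)
Lemma tens_quot_exact (u : M \ox H) :
  tmap (@quotmod_pi _ _ S) idfun u = 0 -> exists v, tmap (@submod_incl _ _ S) idfun v = u.
Proof.
move=> u0; apply/(quotmod_pi0 (im_submodule inc)).
rewrite -[RHS](linear0 (tlift quot_tens_bilin)) -u0.
elim/tens_ind: (u) => [m h|v w IHv IHw]; last by rewrite !linearD /= IHv IHw.
rewrite tmapE; apply: esym; apply: etrans (tliftE _ _ _) _.
exact: quotmod_liftE.
Qed.
End Exact.
End TensorExact.

(** * Local finiteness of G-modules *)

Section LocallyFinite.
Variables (k : comPzRingType) (G : affGroupScheme k).
Hypothesis G_flat : flat_module (coordAlg G).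
Notation H := (coordAlg G).

Section Subcomodule.
Variables (M : gmodule G) (S : submodule M).
Notation i := (@submod_incl k M S).
Hypothesis S_stable : forall x, S x -> exists v, tmap i (@idfun H) v = coact M x.

Let iH_inj : injective (tmap i (@idfun H)) := G_flat (@submod_incl_inj k M S).

(** By flatness [submod_type S \ox H] embeds in [M \ox H], so the chosen preimage is unique; this is
    what makes [sub_coact] linear. *)
Definition sub_coact_spec (x : submod_type S) :
  { v | tmap i (@idfun H) v = coact M (i x) } := cid (S_stable (submod_inclP x)).

Definition sub_coact (x : submod_type S) : submod_type S \ox H :=
  sval (sub_coact_spec x).

Lemma sub_coactE x : tmap i (@idfun H) (sub_coact x) = coact M (i x).
Proof. by rewrite /sub_coact; case: (sub_coact_spec x). Qed.

Fact sub_coact_linear : linear sub_coact.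
Proof.
move=> a x y; apply: iH_inj.
by rewrite [RHS]linearP /= !sub_coactE !linearP.
Qed.
HB.instance Definition _ :=
  GRing.isLinear.Build k (submod_type S) (submod_type S \ox H) *:%R sub_coact
    sub_coact_linear.

(** Each identity is checked after an injection, into [(M \ox H) \ox H] (flatness used twice) or
    into [M], where it follows from the axiom for [M]. *)
Fact sub_coaction : coaction sub_coact.
Proof.
split=> x.
  have iHH_inj := G_flat (f := tmap i (@idfun H)) iH_inj.
  apply: iHH_inj; rewrite /=.
  have -> : tmap (tmap i (@idfun H)) (@idfun H) (tmap sub_coact (@idfun H) (sub_coact x))
      = tmap (coact M) (@idfun H) (coact M (i x)).
    rewrite tmap_comp -sub_coactE tmap_comp.
    by apply: eq_tmap => // y /=; apply: sub_coactE.
  rewrite -[RHS]((coactP M).1 (i x)) -sub_coactE.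
  elim/tens_ind: (sub_coact x) => [y h|u v IHu IHv]; last by rewrite !linearD /= IHu IHv.
  rewrite !tmapE /=.
  elim/tens_ind: (comul G h) => [g g'|u v IHu IHv]; first by rewrite !tassocE !tmapE /= tmapE.
  by rewrite !(tpureDr, linearD) /= IHu IHv.
apply: (@submod_incl_inj k M S); rewrite /counital /= -[RHS]((coactP M).2 (i x)) -sub_coactE.
elim/tens_ind: (sub_coact x) => [y h|u v IHu IHv]; last by rewrite !linearD /= IHu IHv.
by rewrite tmapE !tcontrE linearZ.
Qed.

Definition sub_gmodule : gmodule G := GModule sub_coaction.

Lemma sub_gmodule_incl : @gmap k G sub_gmodule M i.
Proof. by move=> x; rewrite sub_coactE. Qed.
End Subcomodule.

Section LargestSubcomodule.
Variables (M : gmodule G) (S : submodule M).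

Definition coact_mod : M -> quotmod S \ox H :=
  tmap (@quotmod_pi k M S) (@idfun H) \o coact M.
HB.instance Definition _ := GRing.Linear.copy coact_mod
  (tmap (@quotmod_pi k M S) (@idfun H) \o coact M).

(* The x whose coaction lies in the image of S \ox H. *)
Definition coact_core : submodule M := ker_submodule coact_mod.

(** The counit recovers [x] from its coaction, so the class of [x] modulo [S] is the contraction of
    [coact_mod x], which is 0. *)
Lemma coact_core_sub x : coact_core x -> S x.
Proof.
move=> x0; apply/quotmod_pi0; rewrite -{1}((coactP M).2 x).
have -> : quotmod_pi S (tcontr (counit G) (coact M x)) = tcontr (counit G) (coact_mod x).
  rewrite /coact_mod /=.
  elim/tens_ind: (coact M x) => [m h|u v IHu IHv]; last by rewrite !linearD /= IHu IHv.
  by rewrite tmapE !tcontrE linearZ.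
by rewrite [coact_mod x]x0 linear0.
Qed.

(** [coact_mod] is injective on the quotient by its kernel and stays so after tensoring with the
    flat module [H]. By exactness it is then enough that [coact_mod \ox id] kills the coaction of
    [x]; by coassociativity its value is [id \ox comul] applied to [coact_mod x], that is 0. *)
Lemma coact_core_stable x : coact_core x ->
  exists v, tmap (@submod_incl k M coact_core) (@idfun H) v = coact M x.
Proof.
move=> x0; apply: tens_quot_exact.
have lift0 y : coact_core y -> coact_mod y = 0 by [].
have lift_inj : injective (quotmod_lift lift0).
  elim/quotmod_case=> y; elim/quotmod_case=> z.
  rewrite !quotmod_liftE => yz; apply/quotmod_piP.
  by rewrite /coact_core /= linearB yz subrr.
apply: (G_flat lift_inj); rewrite [RHS]linear0 tmap_comp.
rewrite (@eq_tmap _ _ _ _ _ _ coact_mod _ idfun); 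
  [|by move=> y; apply: (quotmod_liftE lift0)|by []].
have -> : tmap coact_mod (@idfun H) (coact M x) =
    tmap (tmap (@quotmod_pi k M S) (@idfun H)) (@idfun H) (tmap (coact M) (@idfun H) (coact M x)).
  by rewrite tmap_comp; apply: eq_tmap => y.
rewrite -(coactP M).1.
have -> : tmap (tmap (@quotmod_pi k M S) (@idfun H)) (@idfun H)
    (tassoc (tmap idfun (comul G) (coact M x))) =
    tassoc (tmap idfun (comul G) (coact_mod x)).
  rewrite /coact_mod /=.
  elim/tens_ind: (coact M x) => [m h|u v IHu IHv]; last by rewrite !linearD /= IHu IHv.
  rewrite !tmapE /=.
  elim/tens_ind: (comul G h) => [g g'|u v IHu IHv]; first by rewrite !tassocE !tmapE /= !tmapE.
  by rewrite !(tpureDr, linearD) /= IHu IHv.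
by rewrite [coact_mod x]x0 !linear0.
Qed.
End LargestSubcomodule.

(** Take the span of the left factors of the tensor [coact M m]. Its [coact_core] contains [m],
    since the coaction of [m] vanishes modulo the span, and is finitely generated because [k] is
    noetherian. *)
Lemma gmodule_locally_finite (k_noeth : noetherian k) (M : gmodule G) (m : M) :
  exists (N : gmodule G) (i : {linear N -> M}),
    [/\ fg_module N, gmap i & exists n, i n = m].
Proof.
have [s Hs] := tens_support (coact M m).
pose C := coact_core (lin_span s).
have [t tC Ct] := noetherian_submodule k_noeth (@coact_core_sub M (lin_span s)).
exists (sub_gmodule (@coact_core_stable M (lin_span s))), (@submod_incl k M C).
split; first exact: fg_submod_type tC Ct.
  exact: sub_gmodule_incl.
apply: submod_inclW; apply: Hs => x xs.
by apply/quotmod_pi0; apply: LinGen.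
Qed.
End LocallyFinite.

(** * The algebra S(M)[eps] / (K eps) *)

Section EpsAlgebra.
Variables (k : comPzRingType) (M : lmodType k) (phi : {linear M -> k^o}).

(* The pair ([:: m_1; ...; m_d], n) stands for the monomial m_1 ... m_d eps^n. *)
Definition monomial : Type := (seq M * nat)%type.

(** Linearity is imposed on the first letter only, as [EpsPerm] brings any letter there. [EpsKer]
    encodes K eps = 0: next to a factor eps, a letter only counts through its value under [phi]. *)
Inductive eps_rel : formal_sum k monomial -> formal_sum k monomial -> Prop :=
| EpsD m m' s n :
    eps_rel [:: (1, (m + m' :: s, n))] [:: (1, (m :: s, n)); (1, (m' :: s, n))]
| EpsZ a m s n : eps_rel [:: (1, (a *: m :: s, n))] [:: (a, (m :: s, n))]
| EpsPerm s t n : perm_eq s t -> eps_rel [:: (1, (s, n))] [:: (1, (t, n))]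
| EpsKer m m' s n :
    phi m = phi m' -> eps_rel [:: (1, (m :: s, n.+1))] [:: (1, (m' :: s, n.+1))].

Lemma eps_compat (P : lmodType k) (f : seq M -> nat -> P) :
    (forall m m' s n, f (m + m' :: s) n = f (m :: s) n + f (m' :: s) n) ->
    (forall a m s n, f (a *: m :: s) n = a *: f (m :: s) n) ->
    (forall s t n, perm_eq s t -> f s n = f t n) ->
    (forall m m' s n, phi m = phi m' -> f (m :: s) n.+1 = f (m' :: s) n.+1) ->
  pres_compat eps_rel (fun w => f w.1 w.2).
Proof.
move=> fD fZ fp fk u v [m m' s n|a m s n|s t n st|m m' s n e];
  rewrite /formal_eval !(big_cons, big_nil) /= !addr0 !scale1r.
- exact: fD.
- exact: fZ.
- exact: fp.
- exact: fk.
Qed.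

Let E := pres eps_rel.
Let gen (s : seq M) (n : nat) : E := pres_gen eps_rel (s, n).

Let genD m m' s n : gen (m + m' :: s) n = gen (m :: s) n + gen (m' :: s) n.
Proof.
have := pres_rel (EpsD m m' s n).
by rewrite /formal_eval !(big_cons, big_nil) /= !addr0 !scale1r.
Qed.

Let genZ a m s n : gen (a *: m :: s) n = a *: gen (m :: s) n.
Proof.
have := pres_rel (EpsZ a m s n).
by rewrite /formal_eval !(big_cons, big_nil) /= !addr0 !scale1r.
Qed.

Let gen_perm s t n : perm_eq s t -> gen s n = gen t n.
Proof.
move=> st; have := pres_rel (EpsPerm n st).
by rewrite /formal_eval !(big_cons, big_nil) /= !addr0 !scale1r.
Qed.

Let gen_ker m m' s n : phi m = phi m' -> gen (m :: s) n.+1 = gen (m' :: s) n.+1.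
Proof.
move=> e; have := pres_rel (EpsKer s n e).
by rewrite /formal_eval !(big_cons, big_nil) /= !addr0 !scale1r.
Qed.

(** The product is obtained by two lifts: first in the left factor, for a fixed monomial on the
    right, then in the right factor. *)
Fact eps_mulr_compat (w : monomial) :
  pres_compat eps_rel (fun v => gen (v.1 ++ w.1) (v.2 + w.2)).
Proof.
apply: (@eps_compat _ (fun s n => gen (s ++ w.1) (n + w.2))) =>
  [m m' s n|a m s n|s t n st|m m' s n e].
- exact: genD.
- exact: genZ.
- by apply: gen_perm; rewrite perm_cat2r.
- exact: gen_ker.
Qed.

Let mulr_gen (w : monomial) : {linear E -> E} := pres_lift (@eps_mulr_compat w).

Let mulr_genE s n t p : mulr_gen (s, n) (gen t p) = gen (t ++ s) (p + n).
Proof. exact: pres_lift_gen. Qed.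

Let gen_ext (P : lmodType k) (f g : {linear E -> P}) :
  (forall s n, f (gen s n) = g (gen s n)) -> f =1 g.
Proof. by move=> fg; apply: pres_ext => -[s n]; apply: fg. Qed.

Fact eps_mul_compat (u : E) : pres_compat eps_rel (fun w => mulr_gen w u).
Proof.
(* The relations act on the head of a list, while the letters of the right factor come last; [swap]
   moves them to the front. *)
have swap s n t p : gen (t ++ s) (p + n) = gen (s ++ t) (n + p).
  by rewrite addnC; apply: gen_perm; rewrite perm_catC.
suff: pres_compat eps_rel (fun w => mulr_gen (w.1, w.2) u).
  by move=> H s t /H; congr (_ = _); apply: eq_bigr => -[a []].
apply: (@eps_compat _ (fun s n => mulr_gen (s, n) u)) => [m m' s n|a m s n|s t n st|m m' s n e].
- apply: (gen_ext (g := mulr_gen (m :: s, n) \+ mulr_gen (m' :: s, n))) => t p /=.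
  by rewrite !mulr_genE !(swap (_ :: s)) genD.
- apply: (gen_ext (g := a \*: mulr_gen (m :: s, n))) => t p /=.
  by rewrite !mulr_genE !(swap (_ :: s)) genZ.
- apply: gen_ext => x p; rewrite !mulr_genE.
  by apply: gen_perm; rewrite perm_cat2l.
- apply: gen_ext => t p; rewrite !mulr_genE !(swap (_ :: s)).
  exact: gen_ker.
Qed.

Definition eps_mul (u v : E) : E := pres_lift (@eps_mul_compat u) v.

Let mul_gen s n t p : eps_mul (gen s n) (gen t p) = gen (s ++ t) (n + p).
Proof. by rewrite /eps_mul pres_lift_gen mulr_genE. Qed.

Let mulrP a (u v w : E) : eps_mul u (a *: v + w) = a *: eps_mul u v + eps_mul u w.
Proof. exact: linearP. Qed.

Let mullP a (u v w : E) : eps_mul (a *: u + v) w = a *: eps_mul u w + eps_mul v w.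
Proof.
elim/pres_ind: w => [|b [s n]|w w' IH IH']; rewrite /eps_mul.
- by rewrite !linear0 addr0.
- by rewrite !pres_liftZ !pres_lift_gen linearP scalerDr !scalerA mulrC.
- by rewrite !pres_liftD -!/(eps_mul _ _) IH IH' scalerDr addrACA.
Qed.

Let E_ind (S : E -> Prop) :
  (forall s n, S (gen s n)) -> (forall a u v, S u -> S v -> S (a *: u + v)) -> forall u, S u.
Proof.
move=> Sg SP; have S0 : S 0.
  by have := SP (-1) _ _ (Sg [::] 0) (Sg [::] 0); rewrite scaleN1r addNr.
apply: pres_ind => [//|a [s n]|u v Su Sv].
  by rewrite -[_ *: _]addr0; apply: SP (Sg s n) S0.
by rewrite -[u]scale1r; apply: SP.
Qed.

Fact eps_mulC : commutative eps_mul.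
Proof.
move=> u v; elim/E_ind: u => [s n|a u u' IH IH']; last by rewrite mullP mulrP IH IH'.
elim/E_ind: v => [t p|a v v' IH IH']; last by rewrite mullP mulrP IH IH'.
by rewrite !mul_gen addnC; apply: gen_perm; rewrite perm_catC.
Qed.

Fact eps_mulA : associative eps_mul.
Proof.
move=> u v w; elim/E_ind: u => [s n|a u u' IH IH']; last by rewrite !mullP IH IH'.
elim/E_ind: v => [t p|a v v' IH IH']; last by rewrite !(mullP, mulrP) IH IH'.
elim/E_ind: w => [r q|a w w' IH IH']; last by rewrite !mulrP IH IH'.
by rewrite !mul_gen catA addnA.
Qed.

Fact eps_mul1 : left_id (gen [::] 0) eps_mul.
Proof.
elim/E_ind=> [s n|a u v IHu IHv]; first by rewrite mul_gen.
by rewrite mulrP IHu IHv.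
Qed.

Fact eps_mulDl : left_distributive eps_mul +%R.
Proof. by move=> u v w; rewrite -[u]scale1r mullP !scale1r. Qed.

Definition eps_ring : Type := pres eps_rel.
HB.instance Definition _ := GRing.Zmodule.on eps_ring.
HB.instance Definition _ := GRing.Zmodule_isComPzRing.Build eps_ring
  eps_mulA eps_mulC eps_mul1 eps_mulDl.

Definition eps_scalar (a : k) : eps_ring := a *: gen [::] 0.

Let eps_scalarE a (u : E) : eps_mul (eps_scalar a) u = a *: u.
Proof.
have mul0 : eps_mul 0 u = 0 by rewrite eps_mulC; apply: linear0.
by rewrite -[eps_scalar a]addr0 mullP eps_mul1 mul0 addr0.
Qed.

Fact eps_scalar_zmod : zmod_morphism eps_scalar.
Proof. by move=> a b; rewrite /eps_scalar scalerBl. Qed.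
HB.instance Definition _ := GRing.isZmodMorphism.Build k eps_ring eps_scalar eps_scalar_zmod.

Fact eps_scalar_monoid : monoid_morphism eps_scalar.
Proof.
split=> [|a b]; first exact: scale1r.
by rewrite -[RHS]/(eps_mul (eps_scalar a) _) eps_scalarE /eps_scalar scalerA.
Qed.
HB.instance Definition _ := GRing.isMonoidMorphism.Build k eps_ring eps_scalar eps_scalar_monoid.

Definition eps_alg : comAlgebra k := @ComAlgebra k eps_ring eps_scalar.

Definition eps_mono (s : seq M) (n : nat) : eps_alg := gen s n.

(* The scaling of a comAlgebra goes through its structure morphism, so it is not
   convertible to the one of the presented module. *)
Lemma eps_alg_scaleE (a : k) (u : eps_alg) : a *: u = a *: (u : E) :> E.
Proof. exact: eps_scalarE. Qed.

Lemma monoD m m' s n : eps_mono (m + m' :: s) n = eps_mono (m :: s) n + eps_mono (m' :: s) n.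
Proof. exact: genD. Qed.

Lemma monoZ a m s n : eps_mono (a *: m :: s) n = a *: eps_mono (m :: s) n.
Proof. by rewrite [RHS]eps_alg_scaleE; apply: genZ. Qed.

Lemma mono_perm s t n : perm_eq s t -> eps_mono s n = eps_mono t n.
Proof. exact: gen_perm. Qed.

Lemma mono_ker m m' s n : phi m = phi m' -> eps_mono (m :: s) n.+1 = eps_mono (m' :: s) n.+1.
Proof. exact: gen_ker. Qed.

Lemma monoM s n t p : eps_mono s n * eps_mono t p = eps_mono (s ++ t) (n + p).
Proof. exact: mul_gen. Qed.

Lemma eps_ind (S : eps_alg -> Prop) :
    (forall s n, S (eps_mono s n)) ->
    (forall a u v, S u -> S v -> S (a *: u + v)) ->
  forall u, S u.
Proof.
move=> Sg SP; apply: E_ind => // a u v Su Sv.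
by rewrite -[a *: u](eps_alg_scaleE a u); apply: SP.
Qed.

Section Lift.
Variables (P : lmodType k) (f : seq M -> nat -> P).
Hypothesis fP : pres_compat eps_rel (fun w => f w.1 w.2).

Definition eps_lift : eps_alg -> P := pres_lift fP.

Fact eps_lift_linear : linear (eps_lift).
Proof.
by move=> a u v; rewrite [X in eps_lift (X + _)]eps_alg_scaleE; apply: linearP.
Qed.
HB.instance Definition _ :=
  GRing.isLinear.Build k eps_alg P *:%R (eps_lift) eps_lift_linear.

Lemma eps_liftE s n : eps_lift (eps_mono s n) = f s n.
Proof. exact: pres_lift_gen. Qed.
End Lift.

End EpsAlgebra.

(** * The coaction on S(M)[eps] / (K eps) *)

Section TensorAlgebra.
Variables (k : comPzRingType) (A B : comAlgebra k).

Definition tensmul (u v : A \ox B) : A \ox B := tconv (@tmul k A) (u \ot v).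

Lemma tensmulE a b a' b' : tensmul (a \ot b) (a' \ot b') = (a * a') \ot (b * b').
Proof. by rewrite /tensmul tconvE /= tmulE. Qed.

Lemma tensmulDl u v w : tensmul (u + v) w = tensmul u w + tensmul v w.
Proof. by rewrite /tensmul tpureDl linearD. Qed.

Lemma tensmulDr u v w : tensmul u (v + w) = tensmul u v + tensmul u w.
Proof. by rewrite /tensmul tpureDr linearD. Qed.

Lemma tensmulZl c u v : tensmul (c *: u) v = c *: tensmul u v.
Proof. by rewrite /tensmul tpureZl [LHS]linearZZ. Qed.

Lemma tensmulZr c u v : tensmul u (c *: v) = c *: tensmul u v.
Proof. by rewrite /tensmul tpureZr [LHS]linearZZ. Qed.

Fact tensmulC : commutative tensmul.
Proof.
move=> u v; elim/tens_ind: u => [a b|u u' IH IH']; last by rewrite tensmulDl tensmulDr IH IH'.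
elim/tens_ind: v => [c d|v v' IH IH']; last by rewrite tensmulDl tensmulDr IH IH'.
by rewrite !tensmulE mulrC [b * d]mulrC.
Qed.

Fact tensmulA : associative tensmul.
Proof.
move=> u v w; elim/tens_ind: u => [a b|u u' IH IH']; last by rewrite !tensmulDl IH IH'.
elim/tens_ind: v => [c d|v v' IH IH']; last by rewrite !(tensmulDl, tensmulDr) IH IH'.
elim/tens_ind: w => [e f|w w' IH IH']; last by rewrite !tensmulDr IH IH'.
by rewrite !tensmulE !mulrA.
Qed.

Fact tensmul1 : left_id ((1 : A) \ot (1 : B)) tensmul.
Proof.
by elim/tens_ind=> [a b|u v IHu IHv]; rewrite ?tensmulE ?mul1r // tensmulDr IHu IHv.
Qed.

HB.instance Definition _ :=
  Monoid.isComLaw.Build (A \ox B) ((1 : A) \ot (1 : B)) tensmul tensmulA tensmulC tensmul1.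

End TensorAlgebra.

Lemma tmul_gmap (k : comPzRingType) (G : affGroupScheme k) (A : comAlgebra k)
    (rho : {linear A -> A \ox coordAlg G}) (rhoP : coaction rho) :
    (forall u v, rho (u * v) = tensmul (rho u) (rho v)) ->
  let B := GModule rhoP in @gmap k G (tensG B B) B (@tmul k A).
Proof.
move=> rhoM B; elim/tens_ind=> [u v|u v IHu IHv]; last by rewrite !linearD /= IHu IHv.
rewrite /= tmulE rhoM tens_coactE /= /tensmul.
elim/tens_ind: (rho u) => [x g|x x' IHx IHx'].
  elim/tens_ind: (rho v) => [y h|y y' IHy IHy'].
    by rewrite !tconvE tmapE.
  by rewrite !(tpureDr, linearD) /= IHy IHy'.
by rewrite !(tpureDl, linearD) /= IHx IHx'.
Qed.

Section ScaleVector.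
Variables (k : comPzRingType) (M : lmodType k) (m : M).

Definition scale_vector (a : k^o) : M := (a : k) *: m.
Fact scale_vector_linear : linear scale_vector.
Proof. by move=> a b c; rewrite /scale_vector scalerDl scalerA. Qed.
HB.instance Definition _ :=
  GRing.isLinear.Build k k^o M *:%R scale_vector scale_vector_linear.
End ScaleVector.

Section EpsCoaction.
Variables (k : comPzRingType) (G : affGroupScheme k) (M : gmodule G).
Variables (phi : {linear M -> trivG G}) (phi_gmap : gmap phi).
Variables (m1 : M) (phi_m1 : phi m1 = (1 : k)).
Notation H := (coordAlg G).
Notation A := (@eps_alg k M phi).
Notation mono := (@eps_mono k M phi).

Definition eps_letter (m : M) : A := mono [:: m] 0.

Fact eps_letter_linear : linear eps_letter.
Proof. by move=> a m m'; rewrite /eps_letter monoD monoZ. Qed.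
HB.instance Definition _ :=
  GRing.isLinear.Build k M A *:%R eps_letter eps_letter_linear.

Lemma mono_cons m s n : mono (m :: s) n = eps_letter m * mono s n.
Proof. by rewrite /eps_letter monoM. Qed.

(** [m] and [phi m] times [m1] have the same image under [phi], hence cannot be told apart next to
    eps. *)
Lemma mono_kerZ m s n : mono (m :: s) n.+1 = (phi m : k) *: mono (m1 :: s) n.+1.
Proof.
rewrite -monoZ; apply: mono_ker; rewrite linearZZ phi_m1.
by rewrite [RHS]mulr1.
Qed.

(* Since eps annihilates the kernel of phi, the left hand side only depends on
   the image of coact M m in k \ox H, which is phi m \ot 1 by equivariance. *)
Lemma letter_coact_ker m s n :
  tensmul (tmap eps_letter (@idfun H) (coact M m)) (mono s n.+1 \ot (1 : H)) =
    ((phi m : k) *: mono (m1 :: s) n.+1) \ot (1 : H).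
Proof.
have step u : tensmul (tmap eps_letter (@idfun H) u) (mono s n.+1 \ot (1 : H)) =
    tmap (scale_vector (mono (m1 :: s) n.+1)) (@idfun H) (tmap phi (@idfun H) u).
  elim/tens_ind: u => [y h|u v IHu IHv]; last by rewrite !linearD /= tensmulDl IHu IHv.
  by rewrite !tmapE /= tensmulE -mono_cons mulr1 mono_kerZ.
by rewrite step -phi_gmap /= tmapE.
Qed.

Let letter_coact (m : M) : A \ox H := tmap eps_letter (@idfun H) (coact M m).
Let unit_tens : A \ox H := (1 : A) \ot (1 : H).

(** The multiplicative extension of the coaction of [M] for which eps is invariant. The iterated
    product is taken for a commutative law, so that reordering the letters is harmless. *)
Definition eps_coact_mono (s : seq M) (n : nat) : A \ox H :=
  tensmul (\big[@tensmul k A H/unit_tens]_(m <- s) letter_coact m)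
          (mono [::] n \ot (1 : H)).

Let eps_coact_mono_cons m s n :
  eps_coact_mono (m :: s) n = tensmul (letter_coact m) (eps_coact_mono s n).
Proof. by rewrite /eps_coact_mono big_cons tensmulA. Qed.

Fact eps_coact_compat : pres_compat (eps_rel phi) (fun w => eps_coact_mono w.1 w.2).
Proof.
apply: eps_compat => [m m' s n|a m s n|s t n st|m m' s n e].
- by rewrite !eps_coact_mono_cons /letter_coact linearD [tmap _ _ _]linearD tensmulDl.
- by rewrite !eps_coact_mono_cons /letter_coact linearZZ [tmap _ _ _]linearZZ tensmulZl.
- by rewrite /eps_coact_mono (perm_big _ st).
- rewrite !eps_coact_mono_cons /eps_coact_mono.
  (* The factor eps^(n+1) is moved next to the coaction of the first letter, where
     [letter_coact_ker] applies. *)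
  rewrite [tensmul (\big[_/_]_(_ <- s) _) _]tensmulC !tensmulA.
  by rewrite /letter_coact !letter_coact_ker e.
Qed.

Definition eps_coact : A -> A \ox H := eps_lift eps_coact_compat.
HB.instance Definition _ := GRing.Linear.copy eps_coact (eps_lift eps_coact_compat).

Lemma eps_coactE s n : eps_coact (mono s n) = eps_coact_mono s n.
Proof. exact: eps_liftE. Qed.

Lemma eps_coactM u v : eps_coact (u * v) = tensmul (eps_coact u) (eps_coact v).
Proof.
elim/eps_ind: u => [s n|a u u' IH IH']; last first.
  by rewrite mulrDl -alg_scaleAl !linearP /= IH IH' tensmulDl tensmulZl.
elim/eps_ind: v => [t p|a v v' IH IH']; last first.
  by rewrite mulrDr -alg_scaleAr !linearP /= IH IH' tensmulDr tensmulZr.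
rewrite monoM !eps_coactE /eps_coact_mono big_cat /=.
have -> : mono [::] (n + p) \ot (1 : H) =
    tensmul (mono [::] n \ot (1 : H)) (mono [::] p \ot (1 : H)).
  by rewrite tensmulE monoM mulr1.
rewrite -!tensmulA; congr tensmul.
by rewrite tensmulA [in RHS]tensmulC -!tensmulA; congr tensmul; apply: tensmulC.
Qed.

Lemma eps_coact_letter m : eps_coact (eps_letter m) = tmap eps_letter (@idfun H) (coact M m).
Proof.
by rewrite eps_coactE eps_coact_mono_cons /eps_coact_mono big_nil tensmul1 tensmulC tensmul1.
Qed.

Lemma eps_coact_eps n : eps_coact (mono [::] n) = mono [::] n \ot (1 : H).
Proof. by rewrite eps_coactE /eps_coact_mono big_nil tensmul1. Qed.

(** Both axioms pass to products because [eps_coact] is multiplicative, so they need only be checked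
    on letters, where they come from [M], and on powers of eps. *)
Fact eps_coaction : coaction eps_coact.
Proof.
have cm (u v : A) : eps_coact (tmul (u \ot v)) =
    tconv (@tmul k A) (eps_coact u \ot eps_coact v).
  by rewrite tmulE eps_coactM.
split.
- elim/eps_ind=> [s n|a u v]; last exact: coassociative_lin.
  elim: s => [|m s IHs].
    by rewrite /coassociative /= eps_coact_eps !tmapE /= comul1 tassocE eps_coact_eps.
  rewrite mono_cons -tmulE; apply: (coassociative_conv cm _ IHs).
  rewrite /coassociative /= eps_coact_letter.
  have -> : tmap eps_coact (@idfun H) (tmap eps_letter (@idfun H) (coact M m)) =
      tmap (tmap eps_letter (@idfun H)) (@idfun H) (tmap (coact M) (@idfun H) (coact M m)).
    by rewrite !tmap_comp; apply: eq_tmap => // y; apply: eps_coact_letter.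
  rewrite -(coactP M).1.
  elim/tens_ind: (coact M m) => [y h|u v IHu IHv]; last by rewrite !linearD /= IHu IHv.
  rewrite !tmapE /=.
  elim/tens_ind: (comul G h) => [g g'|u v IHu IHv]; first by rewrite !tassocE !tmapE /= tmapE.
  by rewrite !(tpureDr, linearD) /= IHu IHv.
- elim/eps_ind=> [s n|a u v]; last exact: counital_lin.
  elim: s => [|m s IHs].
    by rewrite /counital /= eps_coact_eps tcontrE counit1 scale1r.
  rewrite mono_cons -tmulE; apply: (counital_conv cm _ IHs).
  rewrite /counital /= eps_coact_letter -[in RHS]((coactP M).2 m).
  elim/tens_ind: (coact M m) => [y h|u v IHu IHv]; last by rewrite !linearD /= IHu IHv.
  by rewrite tmapE !tcontrE linearZ.
Qed.

Definition eps_galg : galgebra G :=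
  @GAlgebra k G A eps_coact eps_coaction (@tmul_gmap k G A eps_coact eps_coaction eps_coactM).

Lemma eps_letter_generated s x :
  lin_span s x -> alg_generated (mono [::] 1 :: map eps_letter s) (eps_letter x).
Proof.
elim=> [y ys||a y z _ IHy _ IHz].
- by apply: AlgGen; rewrite inE map_f ?orbT.
- rewrite linear0 -[0](rmorph0 (alg_map A)); exact: AlgScal.
- by rewrite linearP; apply: AlgAdd => //; apply: AlgMul => //; apply: AlgScal.
Qed.

Lemma eps_fg : fg_module M -> fg_algebra A.
Proof.
move=> [s Ms]; exists (mono [::] 1 :: map eps_letter s) => u; split=> // _.
elim/eps_ind: u => [t n|a u v Hu Hv]; last first.
  by apply: AlgAdd => //; apply: AlgMul => //; apply: AlgScal.
elim: t => [|m t IHt].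
  elim: n => [|n IHn]; first by rewrite -[mono [::] 0](rmorph1 (alg_map A)); apply: AlgScal.
  have -> : mono [::] n.+1 = mono [::] 1 * mono [::] n by rewrite monoM.
  by apply: AlgMul IHn; apply: AlgGen; rewrite inE eqxx.
by rewrite mono_cons; apply: AlgMul IHt; apply: eps_letter_generated.
Qed.

End EpsCoaction.

(** * Components and coefficients *)

Section SymSeq.
Variables (k : comPzRingType) (M : lmodType k).

(** The product of the letters of [s] in S^d M, with value 0 when the length is not [d]: this makes
    it total on lists and turns it into a projection onto degree [d]. *)
Fixpoint symseq (d : nat) (s : seq M) : sympow M d :=
  match d, s with
  | 0, [::] => symprod [tuple]
  | d'.+1, m :: s' => symcons (m \ot symseq d' s')
  | _, _ => 0
  end.

Lemma symseq_tuple d (t : d.-tuple M) : symseq d t = symprod t.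
Proof.
elim: d t => [|d IHd] t; first by rewrite (tuple0 t).
by case/tupleP: t => m t; rewrite -symconsE -IHd.
Qed.

Lemma symseq_size d s : size s != d -> symseq d s = 0.
Proof. by elim: d s => [|d IHd] [|m s] //= ds; rewrite IHd // linear0 linear0. Qed.

Lemma symseq_perm d s t : perm_eq s t -> symseq d s = symseq d t.
Proof.
move=> st; have [sd|sd] := boolP (size s == d); last by rewrite !symseq_size -?(perm_size st).
have td : size t == d by rewrite -(perm_size st).
rewrite -[s]/(val (Tuple sd)) -[t]/(val (Tuple td)) !symseq_tuple.
exact: symprod_perm.
Qed.

Variable phi : {linear M -> k^o}.

Fact sym_eval_compat d :
  pres_compat (@sym_rel k M d) (fun t => \prod_(m <- t) (phi m : k) : k^o).
Proof.
apply: sym_compat => [t t1 t2 s1 s2 m1 m2 -> -> ->|t t1 s1 s2 a m -> ->|t t1 e].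
- by rewrite !big_cat !big_cons /= linearD mulrDl mulrDr.
- by rewrite !big_cat !big_cons /= linearZ /= -mulrA mulrCA.
- exact: perm_big.
Qed.

(* S^d phi, followed by the isomorphism from S^d k to k. *)
Definition sym_eval d : sympow M d -> k^o := pres_lift (@sym_eval_compat d).
HB.instance Definition _ d :=
  GRing.Linear.copy (@sym_eval d) (pres_lift (@sym_eval_compat d)).

Lemma sym_evalE d (t : d.-tuple M) : sym_eval (symprod t) = \prod_(m <- t) (phi m : k).
Proof. exact: pres_lift_gen. Qed.

Lemma sym_eval_symseq d s :
  sym_eval (symseq d s) = (\prod_(m <- s) (phi m : k)) *+ (size s == d).
Proof.
case: eqP => [<-|/eqP/symseq_size ->]; last by rewrite linear0.
by rewrite (symseq_tuple (in_tuple s)) sym_evalE.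
Qed.

End SymSeq.

Section Components.
Variables (k : comPzRingType) (M : lmodType k) (phi : {linear M -> k^o}).
Notation A := (eps_alg phi).
Notation mono := (@eps_mono k M phi).

(** On monomials, the projection of the bigraded algebra onto its component S^d M of degree 0 in
    eps. *)
Definition mono_proj (d : nat) (s : seq M) (n : nat) : sympow M d :=
  if n is 0 then symseq d s else 0.

Fact eps_proj_compat d : pres_compat (eps_rel phi) (fun w => mono_proj d w.1 w.2).
Proof.
rewrite /mono_proj; apply: (@eps_compat _ _ _ _ (mono_proj d)).
- by case: d => [|d] m m' s [|n] /=; rewrite ?addr0 // tpureDl linearD.
- by case: d => [|d] a m s [|n] /=; rewrite ?scaler0 // tpureZl symconsZ.
- by move=> s t [|n] st //; apply: symseq_perm.
- by [].
Qed.

Definition eps_proj d : A -> sympow M d := eps_lift (@eps_proj_compat d).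
HB.instance Definition _ d := GRing.Linear.copy (@eps_proj d) (eps_lift (@eps_proj_compat d)).

Lemma eps_projE d s n : eps_proj d (mono s n) = mono_proj d s n.
Proof. exact: eps_liftE. Qed.

Lemma eps_proj_letter d m u :
  eps_proj d.+1 (mono [:: m] 0 * u) = symcons (m \ot eps_proj d u).
Proof.
elim/eps_ind: u => [s n|a u v IHu IHv].
  by rewrite monoM !eps_projE; case: n => //=; rewrite linear0 linear0.
by rewrite mulrDr -alg_scaleAr !linearP /= IHu IHv.
Qed.

Lemma eps_proj_letter0 m u : eps_proj 0 (mono [:: m] 0 * u) = 0.
Proof.
elim/eps_ind: u => [s n|a u v IHu IHv]; first by rewrite monoM eps_projE; case: n.
by rewrite mulrDr -alg_scaleAr linearP /= IHu IHv scaler0 addr0.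
Qed.

Lemma mono_head s1 m s2 n : mono (s1 ++ m :: s2) n = mono (m :: s1 ++ s2) n.
Proof. by apply/mono_perm/permPl/(perm_catCA s1 [:: m] s2). Qed.

Fact eps_inj_compat d : pres_compat (@sym_rel k M d) (fun t => mono t 0).
Proof.
apply: sym_compat => [t t1 t2 s1 s2 m1 m2 -> -> ->|t t1 s1 s2 a m -> ->|t t1 e].
- by rewrite !mono_head monoD.
- by rewrite !mono_head monoZ.
- exact: mono_perm.
Qed.

Definition eps_inj d : sympow M d -> A := pres_lift (@eps_inj_compat d).
HB.instance Definition _ d := GRing.Linear.copy (@eps_inj d) (pres_lift (@eps_inj_compat d)).

Lemma eps_injE d (t : d.-tuple M) : eps_inj (symprod t) = mono t 0.
Proof. exact: pres_lift_gen. Qed.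

Lemma eps_inj_symcons d m (u : sympow M d) :
  eps_inj (symcons (m \ot u)) = mono [:: m] 0 * eps_inj u.
Proof.
elim/pres_ind: u => [|a t|u v IHu IHv]; first by rewrite !linear0 mulr0.
  rewrite -[pres_gen _ _]/(symprod t) tpureZr symconsZ symconsE !linearZ /= !eps_injE.
  by rewrite -alg_scaleAr monoM.
by rewrite tpureDr !linearD /= IHu IHv mulrDr.
Qed.

Definition mono_coef (n d : nat) (s : seq M) (p : nat) : k^o :=
  (\prod_(m <- s) (phi m : k)) *+ ((p == n) && (size s == d)).

Fact eps_coef_compat n d : pres_compat (eps_rel phi) (fun w => mono_coef n d w.1 w.2).
Proof.
apply: eps_compat => [m m' s p|a m s p|s t p st|m m' s p e]; rewrite /mono_coef ?big_cons /=.
- by rewrite linearD mulrDl mulrnDl.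
- by rewrite linearZ /= -mulrA -mulrnAr.
- by rewrite (perm_big _ st) (perm_size st).
- by rewrite e.
Qed.

(* S^d phi on the component S^d M eps^n, and 0 on the others. *)
Definition eps_coef n d : A -> k^o := eps_lift (@eps_coef_compat n d).
HB.instance Definition _ n d :=
  GRing.Linear.copy (@eps_coef n d) (eps_lift (@eps_coef_compat n d)).

Lemma eps_coefE n d s p : eps_coef n d (mono s p) = mono_coef n d s p.
Proof. exact: eps_liftE. Qed.

Lemma sym_eval_proj d u : sym_eval phi (eps_proj d u) = eps_coef 0 d u.
Proof.
elim/eps_ind: u => [s n|a u v IHu IHv]; last by rewrite !linearP /= IHu IHv.
rewrite eps_projE eps_coefE /mono_coef; case: n => [|n] /=; last by rewrite linear0.
exact: sym_eval_symseq.
Qed.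

Lemma eps_coef_injM d e (u : sympow M d) (v : sympow M e) :
  eps_coef 0 (d + e) (eps_inj u * eps_inj v) = (sym_eval phi u : k) * sym_eval phi v.
Proof.
elim/pres_ind: u => [|a t|u u' IH IH']; first by rewrite !linear0 !mul0r linear0.
  rewrite -[pres_gen _ _]/(symprod t) !linearZ /= -alg_scaleAl linearZ /= -mulrA; congr (_ * _).
  elim/pres_ind: v => [|b t'|v v' IH IH']; first by rewrite !linear0 !mulr0 linear0.
    rewrite -[pres_gen _ _]/(symprod t') !linearZ /= -alg_scaleAr linearZ /= mulrCA; congr (_ * _).
    rewrite !eps_injE !sym_evalE monoM eps_coefE /mono_coef size_cat !size_tuple eqxx.
    by rewrite big_cat.
  by rewrite !linearD /= !mulrDr linearD /= IH IH'.
by rewrite !linearD /= !mulrDl linearD /= IH IH'.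
Qed.

(** Coefficients multiply as for polynomials in x and eps, and a term of degree 1 in eps takes eps
    from exactly one of the two factors. *)
Lemma eps_coef1M d u v :
  eps_coef 1 d (u * v) = \sum_(i < d.+1)
    ((eps_coef 0 i u : k) * eps_coef 1 (d - i) v + (eps_coef 1 i u : k) * eps_coef 0 (d - i) v).
Proof.
have scE (a : k) (x : k^o) : a *: x = a * x :> k by [].
elim/eps_ind: u => [s n|a u u' IH IH']; last first.
  rewrite mulrDl -alg_scaleAl linearP /= IH IH' scE mulr_sumr -big_split /=.
  apply: eq_bigr => i _.
  rewrite [eps_coef 0 i (_ + _)]linearP [eps_coef 1 i (_ + _)]linearP /= !scE.
  by rewrite mulrDr !mulrDl !mulrA addrACA.
elim/eps_ind: v => [t p|a v v' IH IH']; last first.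
  rewrite mulrDr -alg_scaleAr linearP /= IH IH' scE mulr_sumr -big_split /=.
  apply: eq_bigr => i _.
  rewrite [eps_coef 1 (d - i) (_ + _)]linearP [eps_coef 0 (d - i) (_ + _)]linearP /= !scE.
  by rewrite !mulrDr addrACA; congr (_ + _); rewrite ![a * (_ * _)]mulrCA.
rewrite monoM eps_coefE /mono_coef big_cat size_cat.
set x := \prod_(m <- s) _; set y := \prod_(m <- t) _.
(* For two monomials only the index [i = size s] can contribute, and it is in range exactly when
   [size s <= d]. *)
transitivity (\sum_(i < d.+1) (x * y) *+
    ((size s == i) && (size t == d - i)%N && (n + p == 1)%N)).
  have [sd|sd] := leqP (size s) d.
    rewrite (bigD1 (Ordinal (sd : size s < d.+1)%N)) //= eqxx big1 ?addr0 => [|i].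
      by rewrite andbC -{1}(subnKC sd) eqn_add2l.
    by rewrite -val_eqE eq_sym /= => /negPf ->.
  rewrite big1 => [|i _]; first by rewrite (gtn_eqF (ltn_addr _ sd)) andbF mulr0n.
  by rewrite (gtn_eqF (leq_ltn_trans (leq_ord i) sd)) mulr0n.
apply: eq_bigr => i _; rewrite !eps_coefE /mono_coef -/x -/y.
rewrite !mulrnAr !mulrnAl -!mulrnA -mulrnDr; congr (_ *+ _).
(* The multiplicities agree: [n + p = 1] means that one exponent of eps is 0 and the other is 1. *)
by case: (n) (p) (size s == i) (size t == d - i)%N => [|[|n']] [|[|p']] [] [].
Qed.

Lemma eps_coef_bound n u : exists D, forall d, (D <= d)%N -> eps_coef n d u = 0.
Proof.
elim/eps_ind: u => [s p|a u v [D HD] [D' HD']].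
  exists (size s).+1 => d sd; rewrite eps_coefE /mono_coef.
  by rewrite (ltn_eqF sd) andbF.
exists (maxn D D') => d; rewrite geq_max => /andP[Dd D'd].
by rewrite linearP /= HD // HD' // scaler0 addr0.
Qed.

End Components.

(** * Invariants *)

Section Invariants.
Variables (k : comPzRingType) (G : affGroupScheme k).
Notation H := (coordAlg G).

Lemma ginvariant_gmap (M N : gmodule G) (f : {linear M -> N}) m :
  gmap f -> ginvariant m -> ginvariant (f m).
Proof. by rewrite /ginvariant => fG em; rewrite fG em tmapE. Qed.

Lemma sympow_map_gmap (M N : gmodule G) (f : {linear M -> N}) d :
  gmap f -> @gmap k G (sympowG M d) (sympowG N d) (@sympow_map k M N f d).
Proof.
move=> fG; elim: d => [|d IHd]; elim/pres_ind=> [|a t|u v IHu IHv];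
  rewrite ?linear0 //; try by rewrite !linearD /= IHu IHv.
  rewrite -[pres_gen _ _]/(symprod t) !linearZ /=; congr (_ *: _).
  by rewrite sympow_mapE !sympow_coact0 tmapE /= sympow_mapE.
case/tupleP: t => m t.
rewrite -[pres_gen _ _]/(symprod (cons_tuple m t)) !linearZ /=; congr (_ *: _).
have mapS n (w : sympow M d) : sympow_map f (symcons (n \ot w)) = symcons (f n \ot sympow_map f w).
  elim/pres_ind: w => [|b s|w w' IH IH']; first by rewrite !linear0.
    rewrite -[pres_gen _ _]/(symprod s) tpureZr symconsZ symconsE !linearZ /=.
    congr (_ *: _); rewrite !sympow_mapE symconsE; congr symprod; exact: val_inj.
  by rewrite !(linearD, tpureDr) /= IH IH'.
rewrite -symconsE mapS !sympow_coactS.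
have -> : sympow_coact (sympow_map f (symprod t)) =
    tmap (@sympow_map k M N f d) (@idfun H) (sympow_coact (symprod t)).
  exact: (IHd (symprod t)).
rewrite fG.
elim/tens_ind: (coact M m) => [n g|x x' IHx IHx']; last by rewrite !(tpureDl, linearD) /= IHx IHx'.
elim/tens_ind: (sympow_coact (symprod t)) => [n' h|x x' IHx IHx'].
  by rewrite !tmapE !tconvE tmapE /= mapS.
by rewrite !(tpureDr, linearD) /= IHx IHx'.
Qed.

End Invariants.

Section EpsInvariants.
Variables (k : comPzRingType) (G : affGroupScheme k) (M : gmodule G).
Variables (phi : {linear M -> trivG G}) (phi_gmap : gmap phi).
Variables (m1 : M) (phi_m1 : phi m1 = (1 : k)).
Notation H := (coordAlg G).
Notation A := (@eps_alg k M phi).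
Notation mono := (@eps_mono k M phi).
Notation eps_coact := (eps_coact phi_gmap phi_m1).
Notation letter := (@eps_letter k G M phi).

Definition eps_invariant (a : A) := eps_coact a = a \ot (1 : H).

Lemma eps_invariantM a b : eps_invariant a -> eps_invariant b -> eps_invariant (a * b).
Proof. by rewrite /eps_invariant => ea eb; rewrite eps_coactM ea eb tensmulE mulr1. Qed.

(** Equivariance of the projection, by induction on the letters; it turns invariants of the algebra
    into invariants of S^d M. *)
Lemma eps_proj_gmap d u :
  sympow_coact (eps_proj d u) = tmap (@eps_proj k M phi d) (@idfun H) (eps_coact u).
Proof.
elim/eps_ind: u => [s n|a u v IHu IHv]; last by rewrite !linearP /= IHu IHv.
elim: s d => [|m s IHs] d.
  rewrite eps_coact_eps tmapE /= !eps_projE /mono_proj /=.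
  case: n => [|n] /=; last by rewrite linear0 tpure0l.
  by case: d => [|d] /=; rewrite ?sympow_coact0 // linear0 tpure0l.
rewrite mono_cons eps_coactM eps_coact_letter /eps_letter.
case: d => [|d].
  rewrite eps_proj_letter0 linear0.
  elim/tens_ind: (coact M m) => [y g|x x' IHx IHx'].
    elim/tens_ind: (eps_coact _) => [b h|x x' IHx IHx'].
      by rewrite !tmapE tensmulE tmapE /= eps_proj_letter0 tpure0l.
    by rewrite tensmulDr linearD /= -IHx -IHx' addr0.
  by rewrite linearD tensmulDl linearD /= -IHx -IHx' addr0.
rewrite eps_proj_letter sympow_coactS IHs.
elim/tens_ind: (coact M m) => [y g|x x' IHx IHx'].
  elim/tens_ind: (eps_coact _) => [b h|x x' IHx IHx'].
    by rewrite !tmapE tensmulE tconvE tmapE /= eps_proj_letter.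
  by rewrite linearD tpureDr tensmulDr !linearD /= IHx IHx'.
by rewrite linearD tpureDl tensmulDl !linearD /= IHx IHx'.
Qed.

(** Conversely, invariants of S^d M become invariants of the algebra, where those of different
    degrees can be multiplied. *)
Lemma eps_inj_gmap d (u : sympow M d) :
  eps_coact (eps_inj phi u) = tmap (@eps_inj k M phi d) (@idfun H) (sympow_coact u).
Proof.
elim: d u => [|d IHd]; elim/pres_ind=> [|a t|u v IHu IHv];
  rewrite ?linear0 //; try by rewrite !linearD /= IHu IHv.
  rewrite -[pres_gen _ _]/(symprod t) !linearZ /=; congr (_ *: _).
  by rewrite eps_injE sympow_coact0 tmapE /= eps_injE (tuple0 t) eps_coact_eps.
case/tupleP: t => m t.
rewrite -[pres_gen _ _]/(symprod (cons_tuple m t)) !linearZ /=; congr (_ *: _).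
rewrite -symconsE eps_inj_symcons eps_coactM sympow_coactS IHd.
rewrite -[eps_mono _ _ _]/(letter m) eps_coact_letter.
elim/tens_ind: (coact M m) => [n g|x x' IHx IHx'].
  elim/tens_ind: (sympow_coact (symprod t)) => [n' h|x x' IHx IHx'].
    by rewrite !tmapE tensmulE tconvE tmapE /= eps_inj_symcons.
  by rewrite linearD tpureDr tensmulDr !linearD /= IHx IHx'.
by rewrite linearD tpureDl tensmulDl !linearD /= IHx IHx'.
Qed.

(** By [letter_coact_ker], in the presence of eps the letter [m1] coacts as if it were invariant,
    since [phi m1 = 1]. *)
Lemma eps_invariant_pow d n : eps_invariant (mono (nseq d m1) n.+1).
Proof.
rewrite /eps_invariant; elim: d => [|d IHd]; first exact: eps_coact_eps.
rewrite /= mono_cons eps_coactM IHd eps_coact_letter (letter_coact_ker phi_gmap phi_m1).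
by rewrite phi_m1 scale1r mono_cons.
Qed.

(* The c such that c x^d is in the image of (S^d M)^G in S^d k = k x^d. *)
Definition inv_ideal (d : nat) (c : k) : Prop :=
  exists2 u : sympow M d, sympow_coact u = u \ot (1 : H) & sym_eval phi u = c.

Lemma inv_ideal_comb d a c c' : inv_ideal d c -> inv_ideal d c' -> inv_ideal d (a * c + c').
Proof.
move=> [u eu <-] [u' eu' <-]; exists (a *: u + u'); last by rewrite linearP.
by rewrite linearP /= eu eu' tpureDl tpureZl.
Qed.

Lemma inv_ideal0 d : inv_ideal d 0.
Proof. by exists 0; rewrite !linear0 // tpure0l. Qed.

Lemma inv_idealZ d a c : inv_ideal d c -> inv_ideal d (a * c).
Proof. by move=> Ic; rewrite -[_ * _]addr0; apply: inv_ideal_comb => //; apply: inv_ideal0. Qed.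

Lemma inv_idealD d c c' : inv_ideal d c -> inv_ideal d c' -> inv_ideal d (c + c').
Proof. by move=> Ic Ic'; rewrite -[c]mul1r; apply: inv_ideal_comb. Qed.

Lemma inv_ideal_coef d a : eps_invariant a -> inv_ideal d (eps_coef 0 d a).
Proof.
move=> ea; exists (eps_proj d a); last exact: sym_eval_proj.
by rewrite eps_proj_gmap ea tmapE.
Qed.

(** The two invariants are multiplied inside the algebra, and the product is projected back to
    S^(d+e) M. *)
Lemma inv_idealM d e c c' : inv_ideal d c -> inv_ideal e c' -> inv_ideal (d + e) (c * c').
Proof.
move=> [u eu <-] [u' eu' <-]; rewrite -eps_coef_injM; apply: inv_ideal_coef.
by apply: eps_invariantM; rewrite /eps_invariant eps_inj_gmap ?eu ?eu' tmapE.
Qed.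

Lemma inv_idealX d c n : inv_ideal d c -> inv_ideal (d * n) (c ^+ n).
Proof.
move=> Ic; elim: n => [|n IHn]; last by rewrite mulnS exprS; apply: inv_idealM.
rewrite muln0 expr0; exists (symprod [tuple]); first exact: sympow_coact0.
by rewrite sym_evalE big_nil.
Qed.

(** The sum of the ideals I_d for [d > 0]. *)
Inductive pos_ideal : k -> Prop :=
| PosGen d c : (0 < d)%N -> inv_ideal d c -> pos_ideal c
| Pos0 : pos_ideal 0
| PosComb a c c' : pos_ideal c -> pos_ideal c' -> pos_ideal (a * c + c').

Lemma pos_idealZ a c : pos_ideal c -> pos_ideal (a * c).
Proof. by move=> Pc; rewrite -[_ * _]addr0; apply: PosComb => //; apply: Pos0. Qed.

Lemma pos_idealD c c' : pos_ideal c -> pos_ideal c' -> pos_ideal (c + c').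
Proof. by move=> Pc Pc'; rewrite -[c]mul1r; apply: PosComb. Qed.

(** Modulo [1 - z] every power of [z] is 1; [q] is the geometric sum. It serves to pass from
    comaximal elements to comaximal powers. *)
Lemma one_minus_exp (z : k) n : exists q, 1 = z ^+ n + (1 - z) * q.
Proof.
elim: n => [|n [q eq]]; first by exists 0; rewrite expr0 mulr0 addr0.
exists (z ^+ n + q); rewrite exprS; apply: etrans eq _; ring.
Qed.

(* Comaximal elements of degrees d and e have comaximal powers of degree d e. *)
Lemma pos_ideal_comaximal c : pos_ideal c -> forall a y, a * c + y = 1 ->
  exists d z b, [/\ (0 < d)%N, inv_ideal d z & z = 1 + b * y].
Proof.
elim=> {c} [d c d0 Ic a y e|a y|b c c' _ IHc _ IHc' a y e].
- exists d, (a * c), (-1); split=> //; first exact: inv_idealZ.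
  by rewrite mulN1r -e addrK.
- rewrite mulr0 add0r => ->; exists 1, 0, (-1); split=> //; first exact: inv_ideal0.
  by rewrite mulr1 subrr.
(* The conclusion says that some I_d contains an element congruent to 1 modulo [y]. As [y] is
   arbitrary, [c] is treated first with [a * c'] counted in [y]. *)
have e1 : a * b * c + (a * c' + y) = 1 by rewrite addrA -mulrA -mulrDr.
have [d [z [p [d0 Iz ez]]]] := IHc _ _ e1.
(* Then [c'] is treated, with [z - p * y] in the role of [y]. The result [w] satisfies
   [w - q * z = 1] modulo [y], so [z] and [w] are comaximal modulo [y]. *)
have e2 : - p * a * c' + (z - p * y) = 1 by rewrite ez; ring.
have [e' [w [q [e0 Iw ew]]]] := IHc' _ _ e2.
(* [w] of degree [e'] is raised to the power [d], and a multiple [v] of [z], of degree [d], to the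
   power [e'], so that both land in degree [d * e']. *)
have [r er] := one_minus_exp w d.
have [t et] := one_minus_exp (- r * q * z) e'.
set v := - r * q * z in et.
have ev : 1 - v = w ^+ d + r * q * p * y by rewrite {1}er /v ew; ring.
exists (d * e')%N, (v ^+ e' + t * w ^+ d), (- t * r * q * p); split.
- by rewrite muln_gt0 d0.
- apply: inv_idealD; first by apply: inv_idealX; apply: inv_idealZ.
  by apply: inv_idealZ; rewrite mulnC; apply: inv_idealX.
- by rewrite {1}et ev; ring.
Qed.

(** Induction on the generation of [a]. In a product, each term pairs a coefficient of degree 0 in
    eps with one of degree 1. If the former has positive degree in x it lies in some I_e, because
    the factors are invariant; otherwise the latter has full degree [d >= D] and the induction
    hypothesis applies. *)
Lemma eps_coef1_pos_ideal (s : seq A) D :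
    (forall x, x \in s -> eps_invariant x) ->
    (forall x, x \in s -> forall d, (D <= d)%N -> eps_coef 1 d x = 0) ->
  forall a, alg_generated s a ->
    eps_invariant a /\ forall d, (D <= d)%N -> pos_ideal (eps_coef 1 d a).
Proof.
move=> sinv sD a; elim=> {a} [a sa|c|a b _ [Ia Pa] _ [Ib Pb]|a b _ [Ia Pa] _ [Ib Pb]].
- by split=> [|d Dd]; [apply: sinv|rewrite sD //; apply: Pos0].
- have -> : alg_map A c = c *: mono [::] 0 by rewrite -[LHS]mulr1.
  split=> [|d _]; first by rewrite /eps_invariant linearZ /= eps_coact_eps tpureZl.
  rewrite linearZ /= eps_coefE /mono_coef mulr0n scaler0; exact: Pos0.
- split=> [|d Dd]; first by rewrite /eps_invariant linearD /= Ia Ib tpureDl.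
  by rewrite linearD; apply: pos_idealD; [apply: Pa|apply: Pb].
split=> [|d Dd]; first exact: eps_invariantM.
have coef0 e c : (0 < e)%N -> eps_invariant c -> pos_ideal (eps_coef 0 e c).
  by move=> e0 Ic; apply: PosGen e0 _; apply: inv_ideal_coef.
rewrite eps_coef1M; elim/big_ind: _ => [||i _]; [exact: Pos0|exact: pos_idealD|].
apply: pos_idealD.
  (* Here the left factor gives the coefficient of degree 0 in eps; the critical case is [i = 0]. *)
  have [i0|i0] := posnP i; last by rewrite mulrC; apply/pos_idealZ/coef0.
  by rewrite i0 subn0; apply/pos_idealZ/Pb.
(* Symmetrically, the right factor is now the one of degree 0 in eps, and the critical case is
   [i = d]. *)
have [id|di] := posnP (d - i); last by apply/pos_idealZ/coef0.
have -> : i = d :> nat by apply/eqP; rewrite eqn_leq leq_ord -subn_eq0 id.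
by rewrite mulrC; apply/pos_idealZ/Pa.
Qed.

Lemma fg_invariants_power :
    fg_subalgebra (fun a : eps_galg phi_gmap phi_m1 => ginvariant (M := galg_gmod _) a) ->
  exists2 d : nat, (0 < d)%N & inv_ideal d 1.
Proof.
case=> s Hs; pose s' : seq A := s.
have [D HD] : exists D, forall x, x \in s' -> forall d, (D <= d)%N -> eps_coef 1 d x = 0.
  elim: s' => [|a t [D HD]]; first by exists 0.
  have [D' HD'] := eps_coef_bound 1 a.
  exists (maxn D D') => x; rewrite inE => /predU1P[->|xt] d; rewrite geq_max => /andP[Dd D'd].
    exact: HD'.
  exact: HD.
have sinv x : x \in s' -> eps_invariant x by move=> xs; apply/Hs/AlgGen.
(* The test element x^D eps is invariant with coefficient 1 in degree [D], just beyond the degrees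
   of the eps-linear parts of the generators; so 1 lies in [pos_ideal]. *)
have gen : alg_generated s' (mono (nseq D m1) 1) by apply/Hs/eps_invariant_pow.
have [_ /(_ D (leqnn D))] := eps_coef1_pos_ideal sinv HD gen.
rewrite eps_coefE /mono_coef size_nseq !eqxx mulr1n big1_seq => [P1|m /andP[_]]; last first.
  by rewrite mem_nseq => /andP[_ /eqP ->].
(* With [y = 0] the congruence modulo [y] becomes the equality [z = 1]. *)
have [d [z [b [d0 Iz ez]]]] :=
  pos_ideal_comaximal P1 (a := 1) (y := 0) (etrans (addr0 _) (mul1r _)).
by exists d => //; move: Iz; rewrite ez mulr0 addr0.
Qed.

End EpsInvariants.

(** * Symmetric powers of the trivial module, and the splitting *)

Lemma sym_eval_map (k : comPzRingType) (M N : lmodType k) (f : {linear M -> N})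
    (psi : {linear N -> k^o}) (chi : {linear M -> k^o}) d (u : sympow M d) :
  psi \o f =1 chi -> sym_eval psi (sympow_map f u) = sym_eval chi u.
Proof.
move=> fchi; elim/pres_ind: u => [|a t|u v IHu IHv]; first by rewrite !linear0.
  rewrite -[pres_gen _ _]/(symprod t) !linearZ /= sympow_mapE !sym_evalE big_map.
  by congr (_ * _); apply: eq_bigr => m _; apply: fchi.
by rewrite !linearD /= IHu IHv.
Qed.

Section TrivialPower.
Variables (k : comPzRingType) (G : affGroupScheme k).
Notation H := (coordAlg G).

(** Extracting the scalars from all factors shows that 1...1 generates S^d k, with [sym_eval idfun]
    as coordinate. *)
Lemma sympow_trivE d (v : sympow k^o d) :
  v = (sym_eval (@idfun k^o) v : k) *: symseq d (nseq d (1 : k^o)).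
Proof.
elim/pres_ind: v => [|a t|u v IHu IHv]; first by rewrite linear0 scale0r.
  rewrite -[pres_gen _ _]/(symprod t) linearZ /= -scalerA sym_evalE; congr (_ *: _).
  elim: d t => [|d IHd] t; first by rewrite (tuple0 t) big_nil scale1r.
  case/tupleP: t => x t; rewrite -symconsE IHd big_cons -scalerA /=.
  by rewrite -{1}[x]mulr1 [_ \ot _]tpureZl [X in _ *: X]tpureZr !symconsZ.
by rewrite linearD scalerDl -IHu -IHv.
Qed.

Lemma sympow_triv_coact d (v : sympow (trivG G) d) : sympow_coact v = v \ot (1 : H).
Proof.
elim/pres_ind: v => [|a t|u v IHu IHv]; first by rewrite linear0 tpure0l.
  rewrite -[pres_gen _ _]/(symprod t) linearZ /= tpureZl; congr (_ *: _).
  elim: d t => [|d IHd] t; first exact: (@sympow_coact0 k G (trivG G) t).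
  by case/tupleP: t => x t; rewrite -symconsE sympow_coactS IHd tconvE mulr1.
by rewrite linearD /= IHu IHv tpureDl.
Qed.
End TrivialPower.

Theorem proposition10 (k : comPzRingType) (G : affGroupScheme k)
    (k_noetherian : noetherian k) (G_flat : flat_module (coordAlg G))
    (invariants_fg : forall A : galgebra G,
        fg_algebra A -> fg_subalgebra (fun a : A => ginvariant (M := galg_gmod A) a)) :
  power_reductive G.
Proof.
move=> M phi phi_gmap phi_surj.
have [m phi_m] := phi_surj (1 : k).
(* Reduction to a finitely generated [N] whose image contains a preimage of 1; the restriction [psi]
   of [phi] still takes the value 1. *)
have [N [i [N_fg i_gmap [n in_m]]]] := gmodule_locally_finite G_flat k_noetherian m.
pose psi : {linear N -> trivG G} := phi \o i.
have psi_gmap : gmap psi.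
  by move=> x; rewrite /= phi_gmap i_gmap tmap_comp; apply: eq_tmap.
have psi_n : psi n = (1 : k) by rewrite /= in_m.
have [d d0 [u u_inv psi_u]] :=
  fg_invariants_power (invariants_fg (eps_galg psi_gmap psi_n) (eps_fg psi N_fg)).
exists d => //.
(* The invariant found in S^d N is pushed forward to S^d M, where it still lies above the generator
   of S^d k. *)
pose F : sympow M d := sympow_map i u.
have F_inv : sympow_coact F = F \ot (1 : coordAlg G).
  exact: (@ginvariant_gmap k G (sympowG N d) (sympowG M d) _ u (sympow_map_gmap i_gmap)).
(* The section sends the generator 1...1 of S^d k to [F]; it is equivariant because S^d k has
   trivial action and [F] is invariant. *)
pose s : {linear sympow (trivG G) d -> sympow M d} :=
  scale_vector F \o @sym_eval k _ (@idfun k^o) d.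
exists s; split=> v.
  rewrite [coact _ v]sympow_triv_coact tmapE.
  by rewrite [LHS]linearZ /= F_inv -tpureZl.
(* Both sides are multiples of 1...1, so it remains to see that the coordinate of the image of [F]
   is 1. *)
rewrite [RHS]sympow_trivE [s v]/(_ *: F) [LHS]linearZ; congr (_ *: _).
rewrite [LHS]sympow_trivE.
rewrite (@sym_eval_map _ _ _ _ _ phi) // (@sym_eval_map _ _ _ _ _ psi) //.
by rewrite [sym_eval _ u]psi_u scale1r.
Qed.
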